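(* There does not exist a coarse embedding from any Margulis-type expander into any Selberg-type expander.
   Context: Expander. A sequence of finite graphs $\Gamma_n=(V_n,E_n)$ with $\lim_{n\to\infty}|V_n|=\infty$ such that there are $\varepsilon>0$ and $D\geqslant1$ with $h(\Gamma_n)\geqslant\varepsilon$ and all vertex degrees of $\Gamma_n$ at most $D$, for every $n$. Here $h(\Gamma)=\min\{|\partial A|/|A| : A\subseteq V,\ 1\leqslant|A|\leqslant\frac12|V|\}$ is the Cheeger constant of a finite graph $\Gamma=(V,E)$, and $\partial A$ is the set of edges joining a vertex in $A$ to a vertex in $V\smallsetminus A$. Graphs carry the path metric. Warped cone. Let $(Y,d)$ be a compact metric space with an action by homeomorphisms of a group $G$ with finite symmetric generating set $S$. For $t>0$, let $d_G$ be the largest metric on $\{t\}\times Y$ satisfying $d_G((t,y),(t,y'))\leqslant t\,d(y,y')$ and $d_G((t,y),(t,s.y))\leqslant1$ for all $y,y'\in Y$ and $s\in S$. The warped cone $\mathcal{O}_GY$ is the sequence of metric spaces $(\{t\}\times Y,d_G)_{t\in\mathbb{N}}$. Coarse notions (uniform for sequences). Sequences $(X_n)_n$, $(Y_n)_n$ of metric spaces are uniformly quasi-isometric if there are maps $f_n\colon X_n\to Y_n$ and constants $L\geqslant1$, $A\geqslant0$ independent of $n$ with $L^{-1}d(x,x')-A\leqslant d(f_n(x),f_n(x'))\leqslant L\,d(x,x')+A$ and $d(y,f_n(X_n))\leqslant A$ for all $n$, $x,x'\in X_n$, $y\in Y_n$. A coarse embedding of $(X_n)_n$ into $(Y_n)_n$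 is a family of maps $f_n\colon X_n\to Y_n$ for which there are non-decreasing functions $\eta,\zeta\colon[0,\infty)\to[0,\infty)$, independent of $n$, with $\lim_{r\to\infty}\eta(r)=\infty$ and $\eta(d(x,x'))\leqslant d(f_n(x),f_n(x'))\leqslant\zeta(d(x,x'))$ for all $n$ and $x,x'\in X_n$. Margulis-type expander. An expander that is uniformly quasi-isometric to the warped cone $\mathcal{O}_G\Sigma$ over a measure-preserving action with a free orbit, by Lipschitz homeomorphisms, of a finitely generated group $G$ on a closed surface $\Sigma$ of genus $g\geqslant0$. Box space. Let $G$ be a group generated by a finite set $S$, and let $B(1_G,R)$ be the closed ball of radius $R$ about the identity $1_G$ in the word metric of $S$. Let $(G_n)_n$ be a sequence of finite-index normal subgroups of $G$ such that for every $R\in\mathbb{N}$ there is $n_0\in\mathbb{N}$ with $B(1_G,R)\cap\bigcup_{n\geqslant n_0}G_n=\{1_G\}$. Then the sequence of Cayley graphs $(\mathrm{Cay}(G/G_n,S_n))_n$, where $S_n$ is the image of $S$ in $G/G_n$, is said to define a box space of $G$ (the box space itself being the coarse disjoint union of these graphs, i.e. their disjoint union with a metric that restricts to the given metric on each graph and for which the distance between the $n$th and $m$th graphs, $n\neq m$, tends to infinity as $n+m\to\infty$). Selberg-type expander. An expander that is the sequence of graphs defining a box space of a finitely generated discrete subgroup of $\mathrm{PSL}_2(\mathbb{R})$ or of $\mathrm{SL}_2(\mathbb{R})$. *)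

(* Defs.v *)
From HB Require Import structures.
From Stdlib Require Import Relation_Operators.
From mathcomp Require Import all_boot all_order all_algebra.
From mathcomp Require Import all_classical all_reals all_analysis.

Set Implicit Arguments.
Unset Strict Implicit.
Unset Printing Implicit Defensive.

Import Order.TTheory GRing.Theory Num.Theory.
Import numFieldNormedType.Exports.

Local Open Scope classical_set_scope.
Local Open Scope ring_scope.

Record sgraph := SGraph {
  vertex :> finType;
  edge : rel vertex;
  edge_sym : symmetric edge;
  edge_irrefl : irreflexive edge }.

Section Graphs.
Variables (R : realType) (X : sgraph).
Implicit Types (x y : X) (A : {set X}).

(* An edge of the boundary has exactly one end in [A]: listing it with that
   end first counts it exactly once. *)
Definition edge_boundary A : {set X * X} :=
  [set p : X * X | [&& p.1 \in A, p.2 \notin A & edge p.1 p.2]]%SET.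

(* With values in [\bar R], so that a graph admitting no set [A] as below
   (one with a single vertex) gets the minimum +oo of the empty set. *)
Definition cheeger : \bar R :=
  ereal_inf [set (#|edge_boundary A|%:R / #|A|%:R)%:E |
             A in [set A : {set X} | (1 <= #|A|)%N /\ (2 * #|A| <= #|X|)%N]].

Definition degree x : nat := #|[set y | edge x y]%SET|.

(* The number of edges of a shortest path; only used for connected graphs. *)
Definition path_metric x y : R :=
  inf [set (size p)%:R | p in [set p : seq X | path (@edge X) x p /\ last x p = y]].

End Graphs.

Definition is_expander (R : realType) (X : nat -> sgraph) : Prop :=
  (#|X n| @[n --> \oo] --> \oo) /\
  exists (eps : R) (D : nat), [/\ 0 < eps, (1 <= D)%N,
    forall n, (eps%:E <= cheeger R (X n))%E &
    forall n (x : X n), (degree x <= D)%N].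

Section Coarse.
Variables (R : realType) (X Y : nat -> Type).
Variables (dX : forall n, X n -> X n -> R) (dY : forall n, Y n -> Y n -> R).

(* The last clause says d(y, f_n(X_n)) <= A, the distance to a set being an
   infimum that need not be attained. *)
Definition uniformly_quasi_isometric : Prop :=
  exists (f : forall n, X n -> Y n) (L A : R), [/\ 1 <= L, 0 <= A,
    forall n (x x' : X n),
      L^-1 * dX x x' - A <= dY (f n x) (f n x') <= L * dX x x' + A &
    forall n (y : Y n) (e : R), 0 < e -> exists x, dY y (f n x) < A + e].

Definition coarsely_embeds : Prop :=
  exists (f : forall n, X n -> Y n) (eta zeta : R -> R),
    [/\ forall r : R, 0 <= r -> 0 <= eta r /\ 0 <= zeta r,
        forall r s : R, 0 <= r <= s -> eta r <= eta s /\ zeta r <= zeta s,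
        eta r @[r --> +oo] --> +oo &
        forall n (x x' : X n),
          eta (dX x x') <= dY (f n x) (f n x') <= zeta (dX x x')].

End Coarse.

Section Words.
Variables (G : groupType) (S : set G).

Definition word_ball (r : nat) : set G :=
  [set g | exists w : seq G, [/\ (size w <= r)%N,
    forall s, s \in w -> S s \/ S (s^-1)%g & g = foldr *%g 1%g w]].

Definition generates : Prop := forall g : G, exists r, word_ball r g.

End Words.

Record normal_subgroup (G : groupType) := NormalSubgroup {
  nsub : set G;
  nsub1 : nsub 1%g;
  nsubM : forall x y, nsub x -> nsub y -> nsub (x * y)%g;
  nsubV : forall x, nsub x -> nsub (x^-1)%g;
  nsubJ : forall x y, nsub x -> nsub (y^-1 * x * y)%g }.

Section Quotient.
Variables (G : groupType) (N : normal_subgroup G).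
Implicit Types x y z : G.
Local Open Scope group_scope.

Definition coset_rel : rel G := fun x y => `[< nsub N (x^-1 * y) >].

Fact coset_relxx : reflexive coset_rel.
Proof. by move=> x; apply/asboolP; rewrite mulVg; exact: nsub1. Qed.

Fact coset_rel_sym : symmetric coset_rel.
Proof.
have H x y : coset_rel x y -> coset_rel y x.
  by move=> /asboolP/nsubV; rewrite invgM invgK => ?; apply/asboolP.
by move=> x y; apply/idP/idP; exact: H.
Qed.

Fact coset_rel_trans : transitive coset_rel.
Proof.
move=> y x z /asboolP xy /asboolP yz; apply/asboolP.
by have := nsubM xy yz; rewrite mulgA mulgK.
Qed.

Canonical coset_equiv :=
  EquivRel coset_rel coset_relxx coset_rel_sym coset_rel_trans.

Definition quotient_group : Type := {eq_quot coset_rel}%qT.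

HB.instance Definition _ := Choice.on quotient_group.
HB.instance Definition _ := EqQuotient.on quotient_group.

Definition quot_one : quotient_group := \pi%qT 1.
Definition quot_inv (a : quotient_group) : quotient_group :=
  \pi%qT (repr a)^-1.
Definition quot_mul (a b : quotient_group) : quotient_group :=
  \pi%qT (repr a * repr b).

Fact piE_coset x y :
  nsub N (x^-1 * y) -> \pi_(quotient_group)%qT x = \pi_(quotient_group)%qT y.
Proof. by move=> H; apply/eqmodP/asboolP. Qed.

Fact repr_coset x : nsub N ((repr (\pi_(quotient_group)%qT x))^-1 * x).
Proof. by apply/asboolP/(@eqmodP _ coset_equiv); rewrite reprK. Qed.

Fact quot_mul_pi x y :
  quot_mul (\pi%qT x) (\pi%qT y) = \pi_(quotient_group)%qT (x * y).
Proof.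
apply: piE_coset; set x' := repr _; set y' := repr _.
have Nx : nsub N (x'^-1 * x) by exact: repr_coset.
have Ny : nsub N (y'^-1 * y) by exact: repr_coset.
have := nsubM (nsubJ y' Nx) Ny; rewrite invgM.
by rewrite !mulgA mulgK.
Qed.

Fact quot_inv_pi x : quot_inv (\pi%qT x) = \pi_(quotient_group)%qT x^-1.
Proof.
apply: piE_coset; set x' := repr _.
have Nx : nsub N (x'^-1 * x) by exact: repr_coset.
have := nsubJ (x^-1) (nsubV Nx); rewrite !invgK invgM invgK.
by rewrite !mulgA mulgV mul1g.
Qed.

Fact quot_mulA : associative quot_mul.
Proof.
move=> a b c; rewrite -[a]reprK -[b]reprK -[c]reprK.
by rewrite !quot_mul_pi mulgA.
Qed.

Fact quot_mul1 : left_id quot_one quot_mul.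
Proof. by move=> a; rewrite -[a]reprK quot_mul_pi mul1g. Qed.

Fact quot_mulr1 : right_id quot_one quot_mul.
Proof. by move=> a; rewrite -[a]reprK quot_mul_pi mulg1. Qed.

Fact quot_mulV : left_inverse quot_one quot_inv quot_mul.
Proof. by move=> a; rewrite -[a]reprK quot_inv_pi quot_mul_pi mulVg. Qed.

Fact quot_mulrV : right_inverse quot_one quot_inv quot_mul.
Proof. by move=> a; rewrite -[a]reprK quot_inv_pi quot_mul_pi mulgV. Qed.

HB.instance Definition _ := isGroup.Build quotient_group
  quot_mulA quot_mul1 quot_mulr1 quot_mulV quot_mulrV.

Definition finite_index : Prop := finite_set [set: quotient_group].

End Quotient.

(* Adjacency in Cay(Q, T) as a simple graph: generators give right
   multiplication, orientations, loops and multiplicities are dropped. *)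
Definition cayley_edge (Q : groupType) (T : set Q) (x y : Q) : Prop :=
  x <> y /\ exists2 s, T s & (y = x * s \/ x = y * s)%g.

Definition graph_isom (X : sgraph) (Q : Type) (e : Q -> Q -> Prop) : Prop :=
  exists2 f : X -> Q, bijective f & forall x y, edge x y <-> e (f x) (f y).

Definition quotient_set (G : groupType) (N : normal_subgroup G) (S : set G) :
    set (quotient_group N) :=
  [set \pi_(quotient_group N)%qT s | s in S].
Arguments quotient_set {G} N S.

Definition defines_box_space (G : groupType) (S : set G) (X : nat -> sgraph) :
    Prop :=
  exists N : nat -> normal_subgroup G,
    [/\ forall n, finite_index (N n),
        forall r, exists n0,
          word_ball S r `&` \bigcup_(n in [set n | (n0 <= n)%N]) nsub (N n)
            = [set 1%g] &
        forall n, graph_isom (X n) (cayley_edge (quotient_set (N n) S))].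

Section SL2.
Variable R : realType.

Definition SL2 : Type := {A : 'M[R]_2 | \det A == 1}.

HB.instance Definition _ := SubChoice.on SL2.
HB.instance Definition _ := Topological.copy SL2
  (initial_topology (val : SL2 -> 'M[R]_2)).

Fact SL2_one_subproof : \det (1%:M : 'M[R]_2) == 1.
Proof. by rewrite det1. Qed.

Fact SL2_mul_subproof (A B : SL2) : \det (val A *m val B) == 1.
Proof. by rewrite det_mulmx (eqP (valP A)) (eqP (valP B)) mulr1. Qed.

Fact SL2_unit (A : SL2) : val A \in unitmx.
Proof. by rewrite unitmxE (eqP (valP A)) unitr1. Qed.

Fact SL2_inv_subproof (A : SL2) : \det (invmx (val A)) == 1.
Proof. by rewrite det_inv (eqP (valP A)) invr1. Qed.

Definition SL2_one : SL2 :=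
  @exist 'M[R]_2 (fun A => \det A == 1) _ SL2_one_subproof.
Definition SL2_mul (A B : SL2) : SL2 :=
  @exist 'M[R]_2 (fun A => \det A == 1) _ (SL2_mul_subproof A B).
Definition SL2_inv (A : SL2) : SL2 :=
  @exist 'M[R]_2 (fun A => \det A == 1) _ (SL2_inv_subproof A).

Fact SL2_mulA : associative SL2_mul.
Proof. by move=> A B C; apply: val_inj; exact: mulmxA. Qed.

Fact SL2_mul1 : left_id SL2_one SL2_mul.
Proof. by move=> A; apply: val_inj; exact: mul1mx. Qed.

Fact SL2_mulr1 : right_id SL2_one SL2_mul.
Proof. by move=> A; apply: val_inj; exact: mulmx1. Qed.

Fact SL2_mulV : left_inverse SL2_one SL2_inv SL2_mul.
Proof. by move=> A; apply: val_inj; exact: mulVmx (SL2_unit A). Qed.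

Fact SL2_mulrV : right_inverse SL2_one SL2_inv SL2_mul.
Proof. by move=> A; apply: val_inj; exact: mulmxV (SL2_unit A). Qed.

HB.instance Definition _ := isGroup.Build SL2
  SL2_mulA SL2_mul1 SL2_mulr1 SL2_mulV SL2_mulrV.

Definition pm1 : set SL2 := [set A | val A = 1%:M \/ val A = - 1%:M].

Fact pm1_one : pm1 1%g. Proof. by left. Qed.

Fact pm1_mul (A B : SL2) : pm1 A -> pm1 B -> pm1 (A * B)%g.
Proof.
rewrite /pm1/=; case=> -> [] ->; rewrite ?mulNmx ?mulmxN mulmx1 ?opprK;
  by [left|right].
Qed.

Fact pm1_inv (A : SL2) : pm1 A -> pm1 (A^-1)%g.
Proof.
have eqV (B : SL2) : (B * B = 1)%g -> (B^-1 = B)%g.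
  by move=> BB; rewrite -[LHS]mulg1 -BB mulKg.
move=> pA; rewrite eqV//; apply: val_inj => /=.
by case: pA => ->; rewrite ?mulNmx ?mulmxN mulmx1 ?opprK.
Qed.

Fact pm1_conj (A B : SL2) : pm1 A -> pm1 (B^-1 * A * B)%g.
Proof.
case=> e; [left|right]; rewrite /= e ?mulmxN ?mulNmx mulmx1;
  by rewrite mulVmx ?SL2_unit.
Qed.

Definition SL2_center : normal_subgroup SL2 :=
  NormalSubgroup pm1_one pm1_mul pm1_inv pm1_conj.

Definition PSL2 : Type := quotient_topology (quotient_group SL2_center).

HB.instance Definition _ := Topological.on PSL2.
HB.instance Definition _ := isGroup.Build PSL2
  (@quot_mulA _ SL2_center) (@quot_mul1 _ SL2_center)
  (@quot_mulr1 _ SL2_center) (@quot_mulV _ SL2_center)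
  (@quot_mulrV _ SL2_center).

End SL2.

Definition discrete_set (T : topologicalType) (H : set T) : Prop :=
  H `<=` isolated H.

(* [G] is identified with its image, a subgroup of SL_2(R) or of PSL_2(R)
   whose subspace topology is discrete. *)
Definition selberg_type_expander (R : realType) (X : nat -> sgraph) : Prop :=
  is_expander R X /\
  exists (G : groupType) (S : set G),
    [/\ finite_set S, generates S,
        (exists i : G -> SL2 R,
           [/\ {morph i : g h / (g * h)%g}, injective i &
               discrete_set (range i)]) \/
        (exists i : G -> PSL2 R,
           [/\ {morph i : g h / (g * h)%g}, injective i &
               discrete_set (range i)]) &
        defines_box_space S X].

#[short(type="pmetricType")]
HB.structure Definition PointedMetric (K : numDomainType) :=
  { M of Metric K M & isPointed M }.

Notation borelType T := (g_sigma_algebraType (@open T)).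

Section Surface.
Variable R : realType.

Definition closed_disc : set (R * R) := [set z | z.1 ^+ 2 + z.2 ^+ 2 <= 1].

(* The disc is viewed as a polygon with 4g sides (2 sides if g = 0): for an
   integer k and 0 <= s <= 1, [boundary_point g (k + s)] runs through the
   side number k, counterclockwise. *)
Definition nb_sides (g : nat) : nat := if g is 0 then 2 else (4 * g)%N.

Definition boundary_point (g : nat) (a : R) : R * R :=
  (cos (2 * pi * a / (nb_sides g)%:R), sin (2 * pi * a / (nb_sides g)%:R)).

(* The sides are paired according to the word a a^-1 if g = 0, and
   a_1 b_1 a_1^-1 b_1^-1 .. a_g b_g a_g^-1 b_g^-1 otherwise. *)
Definition side_pairing (g : nat) (a b : R) : Prop :=
  exists2 s : R, 0 <= s <= 1 &
    if g is 0 then a = s /\ b = 2 - s else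
    exists2 k : nat, (k < g)%N &
      (a = (4 * k)%:R + s /\ b = (4 * k + 3)%:R - s) \/
      (a = (4 * k + 1)%:R + s /\ b = (4 * k + 4)%:R - s).

Definition glued (g : nat) : R * R -> R * R -> Prop :=
  clos_refl_sym_trans _ (fun z w => exists a b : R,
    [/\ side_pairing g a b, z = boundary_point g a & w = boundary_point g b]).

(* [T] is the polygon with its sides identified: the map below induces a
   continuous bijection, hence a homeomorphism, from the (compact) quotient of
   the disc onto [T], which is Hausdorff. *)
Definition has_genus (T : topologicalType) (g : nat) : Prop :=
  exists q : R * R -> T,
    [/\ {within closed_disc, continuous q}, q @` closed_disc = [set: T] &
        forall z w, closed_disc z -> closed_disc w ->
          (q z = q w <-> glued g z w)].

Variables (T : pmetricType R) (mu : {measure set (borelType T) -> \bar R}).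

(* A chart of [T] on the open set [U], with values in the plane. It is
   bi-Lipschitz, and compares [mu] with the Lebesgue measure of the plane. *)
Definition is_chart (U : set T) (phi : T -> R * R) : Prop :=
  [/\ open U, open (phi @` U) &
    exists2 L : R, 1 <= L &
      (forall x y, U x -> U y ->
        L^-1 * mdist x y <= `|phi x - phi y| <= L * mdist x y) /\
      (forall B : set (borelType T), measurable B -> B `<=` U ->
        let area := (lebesgue_measure \x lebesgue_measure)%E (phi @` B) in
        (L^-1%:E * area <= mu B <= L%:E * area)%E)].

(* [g] determines the topological surface (compact, connected, orientable, of
   genus g). The charts tie the metric and the measure to the structure of a
   surface; the distance and the area of any Riemannian metric qualify. *)
Definition is_closed_surface (g : nat) : Prop :=
  [/\ compact [set: T], has_genus T g &
      forall x : T, exists U phi, U x /\ is_chart U phi].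

End Surface.

Definition is_metric (R : realType) (T : Type) (d : T -> T -> R) : Prop :=
  [/\ forall x y, d x y = 0 <-> x = y,
      forall x y, d x y = d y x &
      forall x y z, d x z <= d x y + d y z].

Record is_action (G : groupType) (T : Type) (act : G -> T -> T) : Prop := {
  act1 : forall y, act 1%g y = y;
  actM : forall g h y, act (g * h)%g y = act g (act h y) }.

Section WarpedCone.
Variables (R : realType) (T : metricType R) (G : groupType) (S : set G).
Variable act : G -> T -> T.

Definition warped_admissible (t : R) (d : T -> T -> R) : Prop :=
  [/\ is_metric d,
      forall y y', d y y' <= t * mdist y y' &
      forall s y, S s -> d y (act s y) <= 1].

(* The level {t} x T of the cone is identified with T. *)
Definition is_warped_metric (t : R) (d : T -> T -> R) : Prop :=
  warped_admissible t d /\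
  forall d', warped_admissible t d' -> forall y y', d' y y' <= d y y'.

End WarpedCone.

(* All the maps of a group action being Lipschitz, they are homeomorphisms.
   The n-th graph is compared with the level t = n + 1: there is no level
   t = 0. *)
Definition margulis_type_expander (R : realType) (X : nat -> sgraph) : Prop :=
  is_expander R X /\
  exists (g : nat) (T : pmetricType R)
         (mu : {measure set (borelType T) -> \bar R})
         (G : groupType) (S : set G) (act : G -> T -> T)
         (dcone : nat -> T -> T -> R),
    [/\ is_closed_surface mu g,
        [/\ finite_set S, forall s, S s -> S (s^-1)%g & generates S],
        [/\ is_action act,
            forall h, exists k : R,
              forall y y', mdist (act h y) (act h y') <= k * mdist y y',
            forall h (B : set (borelType T)), measurable B ->
              mu (act h @^-1` B) = mu B &
            exists y, forall h, act h y = y -> h = 1%g],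
        forall n, is_warped_metric S act n.+1%:R (dcone n) &
        uniformly_quasi_isometric (fun n => @path_metric R (X n)) dcone].

(* Main.v *)
Require Import Defs.
From mathcomp Require Import all_boot all_order all_algebra.
From mathcomp Require Import all_classical all_reals all_analysis.
From mathcomp Require Import lra ring zify.

(** Only the local geometry of the two families matters. Near a point with
    trivial stabiliser, no nontrivial short word brings a small chart back to
    itself, so that at a high level [t] of the warped cone the metric of the
    chart, rescaled by [t], is only distorted boundedly on bounded sets: this
    gives uniformly coarsely embedded copies of the grids [L x L], for every
    [L]. A box space locally looks like the group, and a discrete subgroup of
    [SL_2(R)] or [PSL_2(R)] acts properly on the upper half plane. So it suffices
    that large grids do not embed uniformly coarsely into the half plane. There, a compactly supported function that is
    Lipschitz for the Euclidean metric has hyperbolic gradient at most [y], and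
    the sum of [y] over [n] uniformly separated points in a disc of radius [H]
    about a boundary point is [O(H log n)]. In a grid with [n = L^2] points this
    forces the function to be almost constant away from [O((log n)^2)] points,
    so the points concentrate near the boundary at ever smaller scales. *)

Set Implicit Arguments.
Unset Strict Implicit.
Unset Printing Implicit Defensive.

Import Order.TTheory GRing.Theory Num.Theory.
Import numFieldNormedType.Exports.

Local Open Scope classical_set_scope.
Local Open Scope ring_scope.

(** * Grids in the upper half plane *)

Lemma chain_variation (R : realType) (N : nat) (f g : 'I_N -> R) :
  (forall j, 0 <= g j) ->
  (forall j k : 'I_N, j.+1 = k -> `|f j - f k| <= g j) ->
  forall j k, `|f j - f k| <= \sum_i g i.
Proof.
move=> g0 fg.
suff H (j k : 'I_N) : (j <= k)%N -> `|f j - f k| <= \sum_i g i.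
  move=> j k; have [/H//|/ltnW/H] := leqP j k.
  by rewrite distrC.
have {}H : forall m (k : 'I_N), (k : nat) = (j + m)%N ->
    `|f j - f k| <= \sum_(i < N | (j <= i < k)%N) g i.
  elim=> [|m IH] {}k km.
    have -> : k = j by apply: val_inj; rewrite /= km addn0.
    by rewrite subrr normr0 sumr_ge0.
  have k'N : (j + m < N)%N by rewrite (leq_ltn_trans _ (ltn_ord k))// km addnS.
  pose k' := Ordinal k'N.
  have k'k : k'.+1 = k by rewrite km addnS.
  rewrite (bigD1 k')/=; last by rewrite -k'k leq_addr/=.
  rewrite (le_trans (ler_distD (f k') _ _))// addrC lerD// ?fg//.
  rewrite (le_trans (IH k' erefl))// le_eqVlt; apply/orP; left; apply/eqP.
  apply: eq_bigl => i; rewrite -k'k ltnS -val_eqE/= -andbA; congr andb.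
  by rewrite ltn_neqAle andbC.
move=> jk; apply: (le_trans (H (k - j)%N k _)); first by rewrite subnKC.
by rewrite big_mkcond/= ler_sum// => i _; case: ifP.
Qed.

(** * Counting separated points in dyadic boxes of the half plane *)

Section Tiles.
Variables (R : realType) (T : finType) (X Y : T -> R) (M : nat).
Hypothesis tileP : forall a t : R, 0 < t ->
  (#|[set z | (a <= X z <= a + t)%R && (t / 2 <= Y z <= t)%R]%SET| <= M)%N.

(** The boxes of [tileP] all have the same hyperbolic shape, so one [M] serves every [a] and [t].
    The strip is halved [p] times, down to such boxes. *)
Lemma strip_count p (a t : R) : 0 < t ->
  (#|[set z | (a <= X z <= a + t * 2 ^+ p)%R && (t / 2 <= Y z <= t)%R]%SET|
     <= 2 ^ p * M)%N.
Proof.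
move=> t0; elim: p a => [|p IH] a.
  by rewrite expr0 mulr1 mul1n; exact: tileP.
rewrite expnS mul2n -addnn mulnDl.
apply: leq_trans (leq_add (IH a) (IH (a + t * 2 ^+ p))).
rewrite -cardsUI (leq_trans _ (leq_addr _ _))// subset_leq_card//.
apply/fintype.subsetP => z; rewrite !inE exprS => /andP[/andP[X1 X2] ->].
rewrite !andbT X1/=; have [XL|/ltW ->//=] := leP (X z) (a + t * 2 ^+ p).
  by [].
by rewrite -addrA -mulrDr -mulr2n -[_ *+ 2]mulr_natl.
Qed.

(** At height [B / 2 ^+ l] it takes [2 ^ l.+1] boxes to span the width [2 * B], and these numbers
    form a geometric series. *)
Lemma rectangle_count L (a B : R) : 0 < B ->
  (#|[set z | (a <= X z <= a + B * 2)%R && (B / 2 ^+ L <= Y z <= B)%R]%SET|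
     <= 2 ^ L.+1 * M)%N.
Proof.
move=> B0; elim: L => [|L IH].
  apply: leq_trans (strip_count 1 a B0); apply: subset_leq_card.
  apply/fintype.subsetP => z; rewrite !inE expr1 expr0 divr1 => /andP[-> /andP[Y1 ->]].
  by rewrite andbT/= (le_trans _ Y1)//; lra.
rewrite expnS mul2n -addnn mulnDl.
have tL : 0 < B / 2 ^+ L by rewrite divr_gt0// exprn_gt0.
have := leq_add IH (strip_count L.+1 a tL); apply: leq_trans.
rewrite -cardsUI (leq_trans _ (leq_addr _ _))// subset_leq_card//.
apply/fintype.subsetP => z; rewrite !inE => /andP[Xz /andP[Y1 Y2]] /=.
have -> : B / 2 ^+ L * 2 ^+ L.+1 = B * 2.
  by rewrite exprS; field; rewrite expf_neq0//.
rewrite Xz Y2 andbT/=; have [//|/ltW YL/=] := leP (B / 2 ^+ L) (Y z).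
by rewrite -mulrA -invfM -exprSr Y1 YL.
Qed.


(* Each of the [L] dyadic layers of the rectangle has weight at most [2 M B]. *)
Lemma rectangle_weight L (a B : R) : 0 < B ->
  \sum_(z | (a <= X z <= a + B * 2) && (Y z <= B)) Y z <=
    B * (2 * M * L)%:R + B * #|T|%:R / 2 ^+ L.
Proof.
move=> B0.
have BL l : 0 < B / 2 ^+ l by rewrite divr_gt0// exprn_gt0.
have H : \sum_(z | (a <= X z <= a + B * 2) && (B / 2 ^+ L < Y z <= B)) Y z
    <= B * (2 * M * L)%:R.
  elim: L => [|L IH].
    rewrite muln0 mulr0 big_pred0// => z; rewrite expr0 divr1.
    by apply/negbTE; apply/negP => /andP[_ /andP[/lt_le_trans h /h]]; rewrite ltxx.
  have -> : B * (2 * M * L.+1)%:R = B * (2 * M * L)%:R + B * (2 * M)%:R.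
    by rewrite mulnS natrD; ring.
  rewrite (bigID (fun z => B / 2 ^+ L < Y z))/= lerD//.
    rewrite (le_trans _ IH)// le_eqVlt; apply/orP; left; apply/eqP.
    apply: eq_bigl => z; case: (boolP (B / 2 ^+ L < Y z)) => h; last first.
      by rewrite andbF/= andbF.
    rewrite andbT/= (lt_trans _ h)//= ltr_pM2l// ltf_pV2 ?posrE ?exprn_gt0//.
    by rewrite exprS ltr_pMl ?exprn_gt0// ltr1n.
  set A := [set z | (a <= X z <= a + B / 2 ^+ L * 2 ^+ L.+1) &&
                    (B / 2 ^+ L / 2 <= Y z <= B / 2 ^+ L)]%SET.
  apply: (@le_trans _ _ (\sum_(z in A) B / 2 ^+ L)).
    rewrite big_mkcond [leRHS]big_mkcond; apply: ler_sum => z _.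
    case: ifP => [/andP[/andP[Xz /andP[Y1 _]]]|_]; last by case: ifP => // _; exact: ltW.
    rewrite -leNgt => YL; rewrite inE YL.
    have -> : B / 2 ^+ L * 2 ^+ L.+1 = B * 2.
      by rewrite exprS; field; rewrite expf_neq0.
    by rewrite Xz andbT -mulrA -invfM -exprSr (ltW Y1).
  rewrite sumr_const -[leLHS]mulr_natr.
  apply: (@le_trans _ _ (B / 2 ^+ L * (2 ^ L.+1 * M)%:R)).
    by rewrite ler_pM2l// ler_nat strip_count.
  rewrite le_eqVlt; apply/orP; left; apply/eqP.
  rewrite !natrM natrX exprS.
  by field; rewrite expf_neq0.
rewrite (bigID (fun z => B / 2 ^+ L < Y z))/= lerD//.
  rewrite (le_trans _ H)// le_eqVlt; apply/orP; left; apply/eqP.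
  by apply: eq_bigl => z; rewrite -andbA [(Y z <= B) && _]andbC.
(* Points below all the layers are bounded one by one; once [2 ^+ L] reaches the number of points,
   they contribute at most [B]. *)
apply: (@le_trans _ _ (\sum_(z : T) B / 2 ^+ L)).
  rewrite big_mkcond; apply: ler_sum => z _; case: ifP => [/andP[_]|_].
    by rewrite -leNgt.
  exact: ltW.
by rewrite sumr_const -[leLHS]mulr_natr; lra.
Qed.

End Tiles.

(** Distance at most [k] in the sup metric, written without truncated subtraction. *)
Definition nearby (N k : nat) (z w : 'I_N * 'I_N) : bool :=
  [&& z.1 <= w.1 + k, w.1 <= z.1 + k, z.2 <= w.2 + k & w.2 <= z.2 + k]%N.

Lemma nearby_sym N k (z z' : 'I_N * 'I_N) : nearby k z z' = nearby k z' z.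
Proof. by apply/idP/idP => /and4P[*]; apply/and4P. Qed.

(** Reducing both coordinates modulo [k.+1] is injective on [A]: congruent coordinates that differ
    by at most [k] are equal. *)
Lemma nearby_card N k (A : {set 'I_N * 'I_N}) :
  (forall z w, z \in A -> w \in A -> nearby k z w) -> (#|A| <= k.+1 * k.+1)%N.
Proof.
move=> Ak; pose f (z : 'I_N * 'I_N) : 'I_k.+1 * 'I_k.+1 :=
  (inord (z.1 %% k.+1), inord (z.2 %% k.+1)).
have e (i j : nat) : (i <= j + k)%N -> (j <= i + k)%N ->
    inord (i %% k.+1) = inord (j %% k.+1) :> 'I_k.+1 -> i = j.
  move=> ij ji /(congr1 (fun x => nat_of_ord x)).
  rewrite !inordK ?ltn_mod// => /eqP.
  wlog lij : i j ij ji / (i <= j)%N.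
    by move=> H; have [/H|/ltnW/H h ?] := leqP i j; [exact|apply/esym/h => //; rewrite eq_sym].
  rewrite eq_sym eqn_mod_dvd// => /dvdnP[[|m]]; lia.
have inj : {in A &, injective f}.
  move=> [i j] [i' j'] zA wA; have /and4P[/= h1 h2 h3 h4] := Ak _ _ zA wA.
  by move=> [/(e _ _ h1 h2) /val_inj -> /(e _ _ h3 h4) /val_inj ->].
rewrite -(card_in_imset inj) (leq_trans (max_card _))//.
by rewrite card_prod !card_ord.
Qed.

Lemma max0_dist (R : realDomainType) (p q : R) :
  `|Num.max 0 p - Num.max 0 q| <= `|p - q|.
Proof.
have [p0|p0] := leP p 0; have [q0|q0] := leP q 0 => //.
- by rewrite subrr normr0.
- by rewrite sub0r normrN distrC !ger0_norm; lra.
- by rewrite subr0 !ger0_norm; lra.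
Qed.

(** * Concentration of a grid near the boundary of the half plane *)

Section Grid.
Variables (R : realType) (N : nat).
Implicit Types u w : 'I_N * 'I_N -> R.

Lemma markov_count (T : finType) (f : T -> R) (e : R) (b : nat) :
  (forall i, 0 <= f i) -> 0 < e -> \sum_i f i <= e * b%:R ->
  (#|[set i | (e < f i)%R]%SET| <= b)%N.
Proof.
move=> f0 e0 fb; rewrite -(ler_nat R) -(ler_pM2l e0) (le_trans _ fb)//.
rewrite mulr_natr -sumr_const big_mkcond/= ler_sum// => i _.
by rewrite inE; case: ifP => // /ltW.
Qed.

(* A row or a column along which [w] has sum at most [e] is one along which [u]
   oscillates by at most [e]; such rows and columns all meet each other. *)
Lemma almost_constant u w (e : R) (b : nat) :
  (forall z, 0 <= w z) ->
  (forall z z', nearby 1 z z' -> `|u z - u z'| <= w z) ->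
  0 < e -> \sum_z w z <= e * b%:R -> (b < N)%N ->
  exists u0 : R, (#|[set z | (2 * e < `|u z - u0|)%R]%SET| <= b * b)%N.
Proof.
move=> w0 uw e0 wb bN.
set I := [set i | (e < \sum_j w (i, j))%R]%SET.
set J := [set j | (e < \sum_i w (i, j))%R]%SET.
have Ib : (#|I| <= b)%N.
  apply: markov_count => // [i|]; first exact: sumr_ge0.
  by rewrite pair_bigA/= (eq_bigr w)// => -[].
have Jb : (#|J| <= b)%N.
  apply: markov_count => // [i|]; first exact: sumr_ge0.
  by rewrite exchange_big pair_bigA/= (eq_bigr w)// => -[].
have ex (A : {set 'I_N}) : (#|A| <= b)%N -> exists i, i \notin A.
  move=> Ab; apply/existsP; rewrite -negb_forall; apply/negP => /forallP AT.
  suff : (N <= #|A|)%N by lia.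
  by rewrite -{1}(card_ord N) subset_leq_card//; apply/fintype.subsetP => i _.
have [i0 /[!inE]] := ex _ Ib; rewrite -leNgt => hi0.
have [j0 /[!inE]] := ex _ Jb; rewrite -leNgt => hj0.
have row i j j' : `|u (i, j) - u (i, j')| <= \sum_j w (i, j).
  apply: (chain_variation (f := fun j => u (i, j)) (g := fun j => w (i, j))) => // k l kl.
  by apply: uw; rewrite /nearby/=; lia.
have col j i i' : `|u (i, j) - u (i', j)| <= \sum_i w (i, j).
  apply: (chain_variation (f := fun i => u (i, j)) (g := fun i => w (i, j))) => // k l kl.
  by apply: uw; rewrite /nearby/=; lia.
(* A point outside [I] times [J] lies on a good row or column, which crosses the good column [j0] or
   the good row [i0]: two oscillations, hence [2 * e]. *)
exists (u (i0, j0)).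
apply: (@leq_trans #|finset.setX I J|); last by rewrite cardsX leq_mul.
apply/subset_leq_card/fintype.subsetP => -[i j]; rewrite inE => h.
rewrite finset.in_setX !inE; apply/andP; split; rewrite ltNge; apply/negP => hij.
- have := ler_distD (u (i, j0)) (u (i, j)) (u (i0, j0)).
  have := row i j j0; have := col j0 i i0; lra.
- have := ler_distD (u (i0, j)) (u (i, j)) (u (i0, j0)).
  have := row i0 j j0; have := col j i i0; lra.
Qed.

Variables (X Y : 'I_N * 'I_N -> R) (K : R) (M b L : nat).
Hypothesis Y_gt0 : forall z, 0 < Y z.
Hypothesis K_ge1 : 1 <= K.
Hypothesis lipschitz : forall z z', nearby 1 z z' ->
  Y z' <= K * Y z /\ `|X z' - X z| <= K * Y z.
Hypothesis tileP : forall a t : R, 0 < t ->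
  (#|[set z | (a <= X z <= a + t)%R && (t / 2 <= Y z <= t)%R]%SET| <= M)%N.

(** A quarter is a share that reproduces itself: of two squares that together contain more than half
    of the grid, one contains more than a quarter. *)
Definition heavy (H : R) := exists a,
  (N * N <= 4 * #|[set z | (a <= X z <= a + H)%R && (Y z <= H)%R]%SET|)%N.

Hypothesis b_large :
  128 * K * (3 + 3 * K ^+ 2) * ((2 * M * L)%:R + (N * N)%:R / 2 ^+ L) <= b%:R.
Hypothesis b_small : (4 * (b * b) + 256 * M < N * N)%N.

(* [u] below varies little across the grid except on few points. Its values on
   the many points of height at most [H] being positive, almost all points lie
   on a thin half annulus, of which only the two ends close to the real line can
   contain many points. *)
Lemma heavy_half H : 0 < H -> heavy H -> heavy (H / 2).
Proof.
move=> H0 [a aP].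
(* A tent over the boundary point [a]: at least [H] on the heavy square, zero once [|X - a| + Y]
   exceeds [3 * H]. *)
pose u z := Num.max 0 (3 * H - `|X z - a| - Y z).
(* Size of the support of [u] enlarged by one grid step, which can multiply heights by [K] and shift
   [X] by [K] times the height. *)
pose B := (3 + 3 * K ^+ 2) * H.
have K0 : 0 <= K by apply: le_trans K_ge1.
have K2 : 1 <= K ^+ 2 by rewrite expr_ge1// (le_trans _ K_ge1).
have KK2 : K <= K ^+ 2 by rewrite expr2 ler_peMl// (le_trans _ K_ge1).
have B0 : 0 < B by rewrite mulr_gt0//; lra.
pose D z := (a - B <= X z <= a - B + B * 2) && (Y z <= B).
(* [X] and [Y] each change by at most [K * Y z] along a step, hence the factor 2. *)
pose w z := if D z then 2 * K * Y z else 0.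
have w0 z : 0 <= w z.
  rewrite /w; case: ifP => _; last exact: lexx.
  by rewrite mulr_ge0 ?(ltW (Y_gt0 z))// mulr_ge0// (le_trans _ K_ge1).
have uw z z' : nearby 1 z z' -> `|u z - u z'| <= w z.
  move=> zz'; have [Y1 X1] := lipschitz zz'.
  have [Y2 X2] : Y z <= K * Y z' /\ `|X z - X z'| <= K * Y z'.
    by apply: lipschitz; rewrite nearby_sym.
  have p1 := ler_distD (X z') (X z) a; have p2 := ler_distD (X z) (X z') a.
  rewrite [`|X z' - X z|]distrC in X1 p2.
  have Yz := Y_gt0 z; have Yz' := Y_gt0 z'.
  have KY : Y z <= K * Y z by rewrite ler_peMl// ltW.
  have near_support t : 0 < 3 * H - `|X t - a| - Y t -> t = z \/ t = z' -> D z.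
    move=> ut tz; have n1 := normr_ge0 (X z - a); have n2 := normr_ge0 (X z' - a).
    have [Xt Yt] : `|X z - a| <= B /\ Y z <= B.
      have KH : H <= K * H by rewrite ler_peMl// ltW.
      have KKH : K * H <= K ^+ 2 * H by rewrite ler_wpM2r// ltW.
      rewrite /B mulrDl; case: tz ut => -> ut; first by split; lra.
      have YH : K * Y z' <= K * (3 * H) by rewrite ler_wpM2l//; lra.
      have KKY : K * (K * Y z') <= K * (K * (3 * H)).
        by rewrite ler_wpM2l//; lra.
      have KY2 : K * Y z <= K * (K * Y z') by rewrite ler_wpM2l//; lra.
      by split; lra.
    by rewrite /D Yt andbT; move: Xt; rewrite ler_norml => /andP[? ?]; apply/andP; split; lra.
  rewrite /w; case: ifPn => Dz; last first.
    rewrite /u !max_l ?subrr ?normr0// leNgt; apply/negP => h;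
      by move/negP: Dz; apply; apply: near_support h _; auto.
  have KYz' : `|(3 * H - `|X z - a| - Y z) - (3 * H - `|X z' - a| - Y z')|
              <= 2 * K * Y z.
    by rewrite ler_norml; lra.
  rewrite (le_trans _ KYz')// /u.
  exact: max0_dist.
have wb : \sum_z w z <= H / 64 * b%:R.
  have := rectangle_weight tileP L (a - B) B0; rewrite card_prod !card_ord => DB.
  rewrite /w -big_mkcond/= -mulr_sumr.
  apply: (@le_trans _ _ (2 * K * (B * (2 * M * L)%:R + B * (N * N)%:R / 2 ^+ L))).
    by rewrite ler_wpM2l//; lra.
  (* In [b_large], 128 is 64 times the factor 2 of [w], and [3 + 3 * K ^+ 2] is [B / H]. *)
  have := ler_wpM2l (ltW (divr_gt0 H0 (ltr0n R 64))) b_large.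
  by apply: le_trans; rewrite le_eqVlt; apply/orP; left; apply/eqP; rewrite /B; field;
    rewrite expf_neq0.
have bN : (b < N)%N by nia.
have e0 : 0 < H / 64 by rewrite divr_gt0.
have [u0] := almost_constant w0 uw e0 wb bN.
set E := [set z | _]%SET => Eb.
(* Otherwise the heavy square, where [u] is at least [H], would lie in [E], which has less than a
   quarter of the points. *)
have u0H : H / 2 <= u0.
  rewrite leNgt; apply/negP => u0H.
  have sE : ([set z | (a <= X z <= a + H)%R && (Y z <= H)%R] \subset E)%SET.
    apply/fintype.subsetP => z; rewrite !inE => /andP[/andP[X1 X2] Yz].
    have XH : `|X z - a| <= H by rewrite ler_norml; lra.
    have uH : H <= u z by rewrite /u le_max; apply/orP; right; lra.
    by rewrite (lt_le_trans _ (ler_norm _))//; lra.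
  have := subset_leq_card sE; lia.
(* Off [E], [u] is within [H / 32] of [u0], hence positive, so that [|X - a| + Y] is within [H / 32]
   of [r]. *)
pose r := 3 * H - u0.
pose part c := [set z | (c <= X z <= c + H / 2)%R && (Y z <= H / 2)%R]%SET.
(* Contains the part of the half annulus above height [4 * H / 2 ^+ 6], that is [H / 16]. Below it,
   [|X - a|] is within [3 * H / 32] of [r], which leaves two squares of side [H / 2]. *)
pose high := [set z | (a - 4 * H <= X z <= a - 4 * H + 4 * H * 2)%R &&
                      (4 * H / 2 ^+ 6 <= Y z <= 4 * H)%R]%SET.
have highM : (#|high| <= 128 * M)%N by apply: (rectangle_count tileP 6) => //; lra.
have cover : [set: 'I_N * 'I_N]%SET \subset
    (E :|: high :|: (part (a - r - H / 8) :|: part (a + r - H / 8)))%SET.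
  apply/fintype.subsetP => z _; rewrite !inE.
  have [zE|//] := leP (`|u z - u0|) (2 * (H / 64)) => /=.
  have uz : `|u z - u0| <= H / 32 by lra.
  have uE : u z = 3 * H - `|X z - a| - Y z.
    move: uz; rewrite /u; case: (leP 0 (3 * H - `|X z - a| - Y z)) => // _.
    by rewrite sub0r normrN ler_norml; lra.
  move: uz; rewrite uE ler_norml => /andP[u1 u2].
  have Yz := Y_gt0 z; rewrite /r.
  have [X0|X0] := leP 0 (X z - a).
    rewrite ger0_norm// in u1 u2.
    have [Yh|Yh] := leP (4 * H / 2 ^+ 6) (Y z).
      by apply/orP; left; lra.
    by apply/orP; right; apply/orP; right; lra.
  rewrite ltr0_norm// in u1 u2.
  have [Yh|Yh] := leP (4 * H / 2 ^+ 6) (Y z).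
    by apply/orP; left; lra.
  by apply/orP; right; apply/orP; left; lra.
apply: contrapT => nH.
have small c : (4 * #|part c| < N * N)%N.
  by rewrite ltnNge; apply/negP => h; apply: nH; exists c.
have := subset_leq_card cover; rewrite cardsT card_prod !card_ord.
rewrite leqNgt => /negP; apply.
have := small (a - r - H / 8); have := small (a + r - H / 8).
have := leq_card_setU E high.
set p1 := part _; set p2 := part _.
have := leq_card_setU p2 p1.
have := leq_card_setU (E :|: high) (p2 :|: p1).
move=> [h1 _] [h2 _] [h3 _] h4 h5.
have arith (n e h p q s t v c m : nat) : (v <= s + t)%N -> (t <= q + p)%N ->
    (s <= e + h)%N -> (4 * p < n)%N -> (4 * q < n)%N -> (e <= c)%N ->
    (h <= 128 * m)%N -> (4 * c + 256 * m < n)%N -> (v < n)%N by lia.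
exact: arith h1 h2 h3 h4 h5 Eb highM b_small.
Qed.

(** Repeated halving would put a quarter of finitely many points below every positive height. *)
Lemma grid_absurd : False.
Proof.
have N0 : (0 < N * N)%N by lia.
(* The sum occurs twice so that the square of side [H0] based at minus the sum contains every
   point. *)
pose H0 := 1 + \sum_z (`|X z| + Y z) + \sum_z (`|X z| + Y z).
have XY z : `|X z| + Y z <= \sum_z (`|X z| + Y z).
  rewrite (bigD1 z)//= lerDl sumr_ge0// => t _.
  by rewrite addr_ge0// ltW.
have S0 : 0 <= \sum_z (`|X z| + Y z).
  by apply: sumr_ge0 => t _; rewrite addr_ge0// ltW.
have Hm m : heavy (H0 / 2 ^+ m).
  elim: m => [|m IH].
    exists (- \sum_z (`|X z| + Y z)); rewrite expr0 divr1.
    set A := [set z | _]%SET.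
    have -> : A = [set: _]%SET; last by rewrite cardsT card_prod card_ord leq_pmull.
    apply/setP => z; rewrite !inE; have := XY z; have := Y_gt0 z.
    have : `|X z| <= `|X z| by []; rewrite {1}ler_norml /H0.
    have := normr_ge0 (X z); lra.
  rewrite exprSr invfM mulrA; apply: heavy_half IH.
  by rewrite divr_gt0 ?exprn_gt0// /H0; lra.
(* Larger than every [(Y z)^-1], so that [H0 / 2 ^+ m] falls below the lowest point. *)
pose c := 1 + \sum_z (Y z)^-1.
have c0 : 0 <= c by rewrite addr_ge0// sumr_ge0// => z _; rewrite invr_ge0 ltW.
have [m mP] : exists m : nat, H0 * c < 2 ^+ m.
  exists (Num.bound (H0 * c)); apply: lt_le_trans (archi_boundP _) _.
    by rewrite mulr_ge0// /H0; lra.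
  by rewrite -natrX ler_nat ltnW// ltn_expl.
have [a] := Hm m.
set A := [set z | _]%SET.
have -> : A = finset.set0; last by rewrite cards0; lia.
apply/setP => z; rewrite !inE; apply/negbTE; apply/negP => /andP[_].
rewrite leNgt => /negP; apply.
rewrite ltr_pdivrMr ?exprn_gt0// -ltr_pdivrMl//.
apply: le_lt_trans mP; rewrite mulrC ler_wpM2l//; first by rewrite /H0; lra.
rewrite /c (bigD1 z)//= addrCA lerDl addr_ge0// sumr_ge0// => t _.
by rewrite invr_ge0 ltW.
Qed.

End Grid.

Lemma no_coarse_grid (R : realType) (K : R) (M : nat) : 1 <= K ->
  exists N : nat, forall X Y : 'I_N * 'I_N -> R,
    (forall z, 0 < Y z) ->
    (forall z z', nearby 1 z z' ->
       Y z' <= K * Y z /\ `|X z' - X z| <= K * Y z) ->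
    (forall a t : R, 0 < t ->
       (#|[set z | (a <= X z <= a + t)%R && (t / 2 <= Y z <= t)%R]%SET| <= M)%N) ->
    False.
Proof.
move=> K1; pose c := Num.bound (128 * K * (3 + 3 * K ^+ 2)).
have C0 : 0 <= 128 * K * (3 + 3 * K ^+ 2).
  have K0 : 0 <= K by apply: le_trans K1.
  by rewrite mulr_ge0 ?addr_ge0 ?mulr_ge0 ?exprn_ge0.
have Cc := archi_boundP C0; rewrite -/c in Cc.
pose d := (c * (4 * M + 1))%N; pose m := (16 * (d * d) + 256 * M)%N.
pose l := (2 * m)%N; pose b := (c * (4 * M * l + 1))%N.
exists (2 ^ l)%N => X Y Y0 XY tile.
apply: (@grid_absurd R (2 ^ l) X Y K M b (2 * l)) => //.
  have -> : (2 ^ l * 2 ^ l)%:R / 2 ^+ (2 * l) = 1 :> R.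
    by rewrite -expnD addnn -mul2n natrX divff// expf_neq0.
  rewrite /b [X in _ <= X]natrM [X in _ <= _ * X]natrD.
  have -> : (2 * M * (2 * l) = 4 * M * l)%N by lia.
  by rewrite ler_wpM2r ?addr_ge0// ltW.
have lm : (l.+1 <= 2 * 2 ^ m)%N.
  by have := ltn_expl m (isT : 1 < 2)%N; rewrite /l; lia.
have bd : (b <= d * (2 * 2 ^ m))%N.
  apply: (@leq_trans (d * l.+1)); last by rewrite leq_mul2l lm orbT.
  by rewrite /b /d -[(c * (4 * M + 1) * _)%N]mulnA leq_mul2l; apply/orP; right; nia.
have mm : (m < 2 ^ m * 2 ^ m)%N.
  have := ltn_expl m (isT : 1 < 2)%N => h; apply: (leq_trans h).
  by rewrite leq_pmulr// expn_gt0.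
have -> : (2 ^ l * 2 ^ l = (2 ^ m * 2 ^ m) * (2 ^ m * 2 ^ m))%N.
  by rewrite -!expnD; congr expn; rewrite /l; lia.
have bb : (b * b <= d * (2 * 2 ^ m) * (d * (2 * 2 ^ m)))%N by rewrite leq_mul.
move: (2 ^ m)%N mm bb {lm bd} => q mm bb.
have -> : (4 * (b * b) + 256 * M < q * q * (q * q))%N = true; last by [].
apply: (@leq_ltn_trans (m * (q * q))%N).
  rewrite /m mulnDl; apply: leq_add; last by rewrite leq_pmulr//; lia.
  apply: leq_trans (leq_mul (leqnn 4) bb) _; lia.
by rewrite ltn_mul2r mm andbT; lia.
Qed.

(** * Discrete subgroups of SL2 and PSL2 *)

Section HalfPlane.
Variable R : realType.
Implicit Types A B : 'M[R]_2.

Lemma det_mx22 A : \det A = A 0 0 * A 1 1 - A 0 1 * A 1 0.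
Proof.
rewrite (expand_det_row _ ord0) big_ord_recl big_ord1 /cofactor !det_mx11 !mxE/=.
rewrite !expr1 !expr0 mul1r mulN1r mulrN.
by do ![congr (_ + _)|congr (- _)|congr (_ * _)]; congr (A _ _); apply: val_inj.
Qed.

Lemma mulmx22 A B i j : (A *m B) i j = A i 0 * B 0 j + A i 1 * B 1 j.
Proof.
by rewrite mxE big_ord_recl big_ord1; congr (_ + A _ _ * B _ _); apply: val_inj.
Qed.

(* [A] moves the base point i of the upper half plane to [hp_x A + i * hp_y A]. *)
Definition hp_y A : R := (A 1 0 ^+ 2 + A 1 1 ^+ 2)^-1.
Definition hp_x A : R := (A 0 0 * A 1 0 + A 0 1 * A 1 1) * hp_y A.

(** The squared Frobenius norm; at determinant 1, it is 2 cosh of the hyperbolic distance from i to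
    its image. *)
Definition fro2 A : R := A 0 0 ^+ 2 + A 0 1 ^+ 2 + A 1 0 ^+ 2 + A 1 1 ^+ 2.

Lemma hp_xN A : hp_x (- A) = hp_x A.
Proof. by rewrite /hp_x /hp_y !mxE !mulrNN !sqrrN. Qed.

Lemma hp_yN A : hp_y (- A) = hp_y A.
Proof. by rewrite /hp_y !mxE !sqrrN. Qed.

Lemma fro2N A : fro2 (- A) = fro2 A.
Proof. by rewrite /fro2 !mxE !sqrrN. Qed.

Lemma bottom_row_gt0 A : \det A = 1 -> 0 < A 1 0 ^+ 2 + A 1 1 ^+ 2.
Proof.
rewrite det_mx22 => dA; rewrite lt0r addr_ge0 ?sqr_ge0// andbT.
rewrite paddr_eq0 ?sqr_ge0// !sqrf_eq0; apply/negP => /andP[/eqP c0 /eqP d0].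
by move: dA; rewrite c0 d0 !mulr0 subrr => /eqP; rewrite eq_sym oner_eq0.
Qed.

Lemma hp_y_gt0 A : \det A = 1 -> 0 < hp_y A.
Proof. by move=> /bottom_row_gt0; rewrite invr_gt0. Qed.

Lemma fro2_ge0 A : 0 <= fro2 A.
Proof. by rewrite /fro2 !addr_ge0 ?sqr_ge0. Qed.

Lemma fro2_ge2 A : \det A = 1 -> 2 <= fro2 A.
Proof.
rewrite det_mx22 /fro2 => dA.
have := sqr_ge0 (A 0 0 - A 1 1); have := sqr_ge0 (A 0 1 + A 1 0); nra.
Qed.

Lemma cauchy_schwarz2 (a b x y : R) :
  (a * x + b * y) ^+ 2 <= (a ^+ 2 + b ^+ 2) * (x ^+ 2 + y ^+ 2).
Proof. by rewrite -subr_ge0; have := sqr_ge0 (a * y - b * x); lra. Qed.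

(** The images of i under [A] and [A *m B] are as far apart as i and its image under [B]. A bounded
    hyperbolic move changes both coordinates by a bounded multiple of the height. *)
Lemma hp_mul A B : \det A = 1 -> \det B = 1 ->
  hp_y (A *m B) <= fro2 B ^+ 2 * hp_y A /\
  `|hp_x (A *m B) - hp_x A| <= fro2 B ^+ 2 * hp_y A.
Proof.
move=> dA dB; have q0 := bottom_row_gt0 dA.
have dAB : \det (A *m B) = 1 by rewrite det_mulmx dA dB mulr1.
have q'0 := bottom_row_gt0 dAB.
have F2 := fro2_ge2 dB.
rewrite /hp_x /hp_y; set q := A 1 0 ^+ 2 + _; set q' := _ + _ in q'0 *.
have dB' := dB; have dA' := dA; rewrite !det_mx22 in dA' dB'.
(* The bottom row of [A] is that of [A *m B] times the inverse of [B], whose entries are those of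
   [B] up to order and sign. *)
have qF : q <= fro2 B * q'.
  have c_eq : A 1 0 = (A *m B) 1 0 * B 1 1 + (A *m B) 1 1 * - B 1 0.
    by rewrite -[LHS]mulr1 -dB' !mulmx22; ring.
  have d_eq : A 1 1 = (A *m B) 1 0 * - B 0 1 + (A *m B) 1 1 * B 0 0.
    by rewrite -[LHS]mulr1 -dB' !mulmx22; ring.
  have := cauchy_schwarz2 ((A *m B) 1 0) ((A *m B) 1 1) (B 1 1) (- B 1 0).
  have := cauchy_schwarz2 ((A *m B) 1 0) ((A *m B) 1 1) (- B 0 1) (B 0 0).
  rewrite -c_eq -d_eq -/q' !sqrrN /q /fro2; lra.
have yF : q'^-1 <= fro2 B * q^-1.
  by rewrite ler_pdivlMr// mulrC ler_pdivrMr.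
have F0 := fro2_ge0 B.
split.
  apply: (le_trans yF); rewrite ler_wpM2r ?invr_ge0 ?(ltW q0)//.
  by rewrite expr2 ler_peMl//; lra.
set num := (A 1 1 * B 0 0 - A 1 0 * B 1 0) * (A *m B) 1 0 +
           (A 1 1 * B 0 1 - A 1 0 * B 1 1) * (A *m B) 1 1.
have -> : ((A *m B) 0 0 * (A *m B) 1 0 + (A *m B) 0 1 * (A *m B) 1 1) * q'^-1 -
   (A 0 0 * A 1 0 + A 0 1 * A 1 1) * q^-1 = num * (q'^-1 * q^-1).
  have num_eq : num = ((A *m B) 0 0 * (A *m B) 1 0 + (A *m B) 0 1 * (A *m B) 1 1) * q -
      (A 0 0 * A 1 0 + A 0 1 * A 1 1) * q'.
    by rewrite -[LHS]mulr1 -dA' /num /q /q' !mulmx22; ring.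
  by rewrite num_eq; field; rewrite !gt_eqF.
have numF : `|num| <= fro2 B * q.
  have p1 := cauchy_schwarz2 (A 1 1) (- A 1 0) (B 0 0) (B 1 0).
  have p2 := cauchy_schwarz2 (A 1 1) (- A 1 0) (B 0 1) (B 1 1).
  have p3 := cauchy_schwarz2 (A 1 0) (A 1 1) (B 0 0) (B 1 0).
  have p4 := cauchy_schwarz2 (A 1 0) (A 1 1) (B 0 1) (B 1 1).
  rewrite !mulNr !sqrrN in p1 p2; rewrite -!mulmx22 in p3 p4.
  move: p1 p2; rewrite /num /fro2 /q.
  set u := _ - _; set v := (A 1 1 * B 0 1 - _) => p1 p2.
  (* Each product in [num] is at most half a sum of two squares; [p1] to [p4] bound the four squares
     by [2 * fro2 B * q] in total. *)
  have s1 := sqr_ge0 (u + (A *m B) 1 0); have s2 := sqr_ge0 (u - (A *m B) 1 0).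
  have s3 := sqr_ge0 (v + (A *m B) 1 1); have s4 := sqr_ge0 (v - (A *m B) 1 1).
  by rewrite ler_norml; apply/andP; split; lra.
rewrite normrM (ger0_norm (_ : 0 <= q'^-1 * q^-1)); last by rewrite mulr_ge0 ?invr_ge0 ?ltW.
apply: (@le_trans _ _ (fro2 B * q * (q'^-1 * q^-1))).
  by rewrite ler_wpM2r// mulr_ge0 ?invr_ge0 ?ltW.
have -> : fro2 B * q * (q'^-1 * q^-1) = fro2 B * q'^-1 by field; rewrite !gt_eqF.
by rewrite expr2 -mulrA ler_wpM2l.
Qed.

Lemma invmx22M A B (C := invmx A *m B) : \det A = 1 ->
  [/\ C 0 0 = A 1 1 * B 0 0 - A 0 1 * B 1 0, C 0 1 = A 1 1 * B 0 1 - A 0 1 * B 1 1,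
      C 1 0 = A 0 0 * B 1 0 - A 1 0 * B 0 0 & C 1 1 = A 0 0 * B 1 1 - A 1 0 * B 0 1].
Proof.
move=> dA.
have BC : B = A *m C by rewrite mulKVmx// unitmxE dA unitr1.
move: dA; rewrite det_mx22 => dA.
by split; rewrite -[LHS]mul1r -dA BC !mulmx22; ring.
Qed.

(** The formula for cosh of the hyperbolic distance between the images of i under [A] and [B],
    cleared of denominators. *)
Lemma hp_dist A B : \det A = 1 -> \det B = 1 ->
  fro2 (invmx A *m B) * (hp_y A * hp_y B) =
    (hp_x A - hp_x B) ^+ 2 + hp_y A ^+ 2 + hp_y B ^+ 2.
Proof.
move=> dA dB; have qA := bottom_row_gt0 dA; have qB := bottom_row_gt0 dB.
have [C00 C01 C10 C11] := invmx22M B dA.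
rewrite /fro2 C00 C01 C10 C11 {C00 C01 C10 C11}.
(* At determinant 1 the top row is determined by the bottom row and the image of i. *)
have top D : \det D = 1 -> 0 < D 1 0 ^+ 2 + D 1 1 ^+ 2 ->
    D 0 0 = hp_x D * D 1 0 + hp_y D * D 1 1 /\ D 0 1 = hp_x D * D 1 1 - hp_y D * D 1 0.
  rewrite det_mx22 /hp_x /hp_y => dD qD.
  split.
    rewrite -[X in _ = _ + _ * X]mulr1 -dD.
    by field; rewrite gt_eqF.
  rewrite -[X in _ = _ - _ * X]mulr1 -dD.
  by field; rewrite gt_eqF.
have [-> ->] := top _ dA qA; have [-> ->] := top _ dB qB.
have yA : (A 1 0 ^+ 2 + A 1 1 ^+ 2) * hp_y A = 1 by rewrite mulfV// gt_eqF.
have yB : (B 1 0 ^+ 2 + B 1 1 ^+ 2) * hp_y B = 1 by rewrite mulfV// gt_eqF.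
rewrite -[RHS]mulr1 -[X in _ = _ * X]mulr1 -{1}yA -yB.
ring.
Qed.

End HalfPlane.

Lemma finite_set_ubound (T : choiceType) (R : realType) (A : set T) (f : T -> R) :
  finite_set A -> exists F, forall x, A x -> f x <= F.
Proof.
move=> /finite_seqP[s ->]; exists (\sum_(x <- s) `|f x|) => x /= xs.
rewrite (big_rem x)//= (le_trans (ler_norm _))// lerDl.
by rewrite sumr_ge0.
Qed.

Section WordBall.
Variables (G : groupType) (S : set G).
Implicit Types (g h : G) (r : nat).

Lemma word_ball1 r : word_ball S r 1%g.
Proof. by exists [::]. Qed.

Lemma word_ball_le r r' : (r <= r')%N -> word_ball S r `<=` word_ball S r'.
Proof. by move=> rr' g [w [wr wS ->]]; exists w; rewrite (leq_trans wr). Qed.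

Lemma word_ballM r r' g h :
  word_ball S r g -> word_ball S r' h -> word_ball S (r + r') (g * h)%g.
Proof.
move=> [w [wr wS ->]] [w' [wr' wS' ->]]; exists (w ++ w'); split.
- by rewrite size_cat leq_add.
- by move=> s; rewrite mem_cat => /orP[/wS|/wS'].
- elim: w {wr wS} => /= [|s w <-]; first by rewrite mul1g.
  by rewrite mulgA.
Qed.

Lemma word_ball_gen s : S s \/ S (s^-1)%g -> word_ball S 1 s.
Proof.
move=> Ss; exists [:: s]; split => //= [t|]; last by rewrite mulg1.
by rewrite inE => /eqP ->.
Qed.

Lemma word_ballV r g : word_ball S r g -> word_ball S r (g^-1)%g.
Proof.
move=> [w [wr wS ->]]; apply: (word_ball_le wr).
elim: w wS {wr} => /= [|s w IH] wS; first by rewrite invg1; exact: word_ball1.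
rewrite invgM -addn1; apply: word_ballM.
  by apply: IH => t tw; apply: wS; rewrite inE tw orbT.
apply: word_ball_gen; rewrite invgK.
by case: (wS s (mem_head _ _)); auto.
Qed.

Lemma finite_word_ball r : finite_set S -> finite_set (word_ball S r).
Proof.
move=> finS; elim: r => [|r IH].
  apply: (@sub_finite_set _ _ [set 1%g]) => // g [w [+ _ ->]].
  by rewrite leqn0 => /nilP ->.
apply: (@sub_finite_set _ _ ([set 1%g] `|`
   [set (x * y)%g | x in S `|` [set (s^-1)%g | s in S] & y in word_ball S r])).
  move=> g [[|s w] [wr wS ->]]; [by left|right].
  have [Ss|Ss] := wS s (mem_head _ _).
    exists s; first by left.
    exists (foldr *%g 1%g w) => //; exists w; split => // t tw.
    by apply: wS; rewrite inE tw orbT.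
  exists s; first by right; exists (s^-1)%g; rewrite ?invgK.
  exists (foldr *%g 1%g w) => //; exists w; split => // t tw.
  by apply: wS; rewrite inE tw orbT.
rewrite finite_setU; split => //; apply: finite_image2 => //.
by rewrite finite_setU; split => //; exact: finite_image.
Qed.

Lemma finite_in_word_ball (A : set G) : generates S -> finite_set A ->
  exists r, A `<=` word_ball S r.
Proof.
move=> genS /finite_seqP[s ->].
elim: s => [|g s [r IH]]; first by exists 0%N.
have [r' gr'] := genS g; exists (r + r')%N => h /=.
rewrite inE => /orP[/eqP ->|/IH].
  by apply: word_ball_le gr'; rewrite leq_addl.
by apply: word_ball_le; rewrite leq_addr.
Qed.

End WordBall.

Lemma ord2P (i : 'I_2) : i = 0 \/ i = 1.
Proof. by case: i => -[|[|//]] ?; [left|right]; apply: val_inj. Qed.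

(** * Orbits of discrete groups in the half plane *)

Section DiscreteGroup.
Variables (R : realType) (G : groupType) (S : set G) (rho : G -> 'M[R]_2).
Hypothesis det_rho : forall g, \det (rho g) = 1.
(* The sign is there for [PSL2]. *)
Hypothesis rhoM : forall g h,
  rho (g * h)%g = rho g *m rho h \/ rho (g * h)%g = - (rho g *m rho h).
Variable delta : R.
Hypothesis delta_gt0 : 0 < delta.
Hypothesis rho_sep : forall g h,
  (forall i j, `|(invmx (rho g) *m rho h - 1%:M) i j| < delta) -> g = h.

(** Rounding the bounded entries to a fine mesh gives finitely many matrices, and elements with the
    same rounding coincide by [rho_sep]. *)
Lemma finite_fro2_le (C : R) : 0 <= C -> finite_set [set g | fro2 (rho g) <= C].
Proof.
move=> C0; set A := [set g | _].
have entry g i j : A g -> `|rho g i j| <= 1 + C.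
  rewrite /A/= /fro2 => gC.
  have sq : rho g i j ^+ 2 <= C.
    have h00 := sqr_ge0 (rho g 0 0); have h01 := sqr_ge0 (rho g 0 1).
    have h10 := sqr_ge0 (rho g 1 0); have h11 := sqr_ge0 (rho g 1 1).
    have [->|->] := ord2P i; have [->|->] := ord2P j; lra.
  by rewrite ler_norml; nra.
(* An entry of [invmx (rho g) *m (rho h - rho g)] is a sum of two products of size at most
   [(1 + C) / n]. *)
pose n := (Num.bound (2 * (1 + C) / delta)).+1.
have n0 : 0 < n%:R :> R by rewrite ltr0n.
(* The shift makes the argument nonnegative; [Num.trunc] is 0 on negative numbers. *)
pose e (x : R) : nat := Num.trunc (n%:R * (x + (1 + C))).
pose k := Num.bound (n%:R * (2 * (1 + C))).
pose f g : 'M['I_k.+1]_2 := \matrix_(i, j) inord (e (rho g i j)).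
suff fI : {in A &, injective f}.
  by rewrite -(eq_finite_set (inj_card_eq fI)).
move=> g h; rewrite !inE => Ag Ah /matrixP fgh.
have close i j : `|rho h i j - rho g i j| < n%:R^-1.
  have := fgh i j; rewrite !mxE => /(congr1 (fun x => nat_of_ord x)).
  have pos x : `|x| <= 1 + C -> 0 <= n%:R * (x + (1 + C)) /\ (e x < k.+1)%N.
    rewrite ler_norml => /andP[x1 x2].
    have p : 0 <= n%:R * (x + (1 + C)) by rewrite mulr_ge0//; lra.
    split=> //; rewrite /e ltnS truncn_le_nat.
    apply: (@lt_trans _ _ k%:R); last by rewrite ltr_nat.
    apply: le_lt_trans (archi_boundP _); last by rewrite mulr_ge0//; lra.
    by rewrite ler_pM2l//; lra.
  have [g0 gk] := pos _ (entry g i j Ag); have [h0 hk] := pos _ (entry h i j Ah).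
  rewrite !inordK// /e => eqe.
  have := truncn_itv g0; have := truncn_itv h0; rewrite eqe => /andP[t1 t2] /andP[t3 t4].
  rewrite -(ltr_pM2l n0) mulfV ?gt_eqF// -{1}(ger0_norm (ltW n0)) -normrM.
  rewrite -natr1 in t2 t4.
  by rewrite ltr_norml; lra.
have rho_g : invmx (rho g) *m rho h - 1%:M = invmx (rho g) *m (rho h - rho g).
  by rewrite mulmxBr mulVmx// unitmxE det_rho unitr1.
apply: rho_sep => i j; rewrite rho_g.
have [C00 C01 C10 C11] := invmx22M (rho h - rho g) (det_rho g).
have prod_lt x y u v : `|x| <= 1 + C -> `|y| <= 1 + C -> `|u| < n%:R^-1 -> `|v| < n%:R^-1 ->
    `|x * u - y * v| < delta.
  move=> x1 y1 u1 v1; apply: (@le_lt_trans _ _ (2 * (1 + C) / n%:R)).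
    rewrite (le_trans (ler_normB _ _))// !normrM.
    have -> : 2 * (1 + C) / n%:R = (1 + C) / n%:R + (1 + C) / n%:R by ring.
    by rewrite lerD// ler_pM// ltW.
  rewrite ltr_pdivrMr// [delta * _]mulrC -ltr_pdivrMr//.
  apply: lt_trans (archi_boundP _) _; last by rewrite ltr_nat.
  by rewrite divr_ge0 ?ltW//; lra.
have [->|->] := ord2P i; have [->|->] := ord2P j.
- by rewrite C00 prod_lt ?entry// !mxE.
- by rewrite C01 prod_lt ?entry// !mxE.
- by rewrite C10 prod_lt ?entry// !mxE.
- by rewrite C11 prod_lt ?entry// !mxE.
Qed.

Lemma half_plane_coordinates : finite_set S -> generates S ->
  exists X Y : G -> R,
  [/\ forall g, 0 < Y g,
      forall r, exists2 K, 1 <= K & forall g h, word_ball S r h ->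
        Y (g * h)%g <= K * Y g /\ `|X (g * h)%g - X g| <= K * Y g &
      exists r, forall g h a t, 0 < t ->
        a <= X g <= a + t -> t / 2 <= Y g <= t ->
        a <= X h <= a + t -> t / 2 <= Y h <= t -> word_ball S r (g^-1 * h)%g].
Proof.
move=> finS genS.
exists (fun g => hp_x (rho g)), (fun g => hp_y (rho g)); split.
- by move=> g; exact: hp_y_gt0.
- move=> r; have [F FP] := finite_set_ubound (fun g => fro2 (rho g)) (finite_word_ball r finS).
  have F2 : 2 <= F.
    by apply: le_trans (FP _ (word_ball1 S r)); exact: fro2_ge2.
  exists (F ^+ 2) => [|g h /FP /= hF]; first by rewrite expr_ge1//; lra.
  have hF2 : fro2 (rho h) ^+ 2 * hp_y (rho g) <= F ^+ 2 * hp_y (rho g).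
    by rewrite ler_wpM2r ?(ltW (hp_y_gt0 (det_rho g)))// ler_pXn2r// ?nnegrE ?fro2_ge0//; lra.
  have [h1 h2] := hp_mul (det_rho g) (det_rho h).
  case: (rhoM g h) => ->; rewrite ?hp_xN ?hp_yN;
    by split; [exact: le_trans h1 hF2|exact: le_trans h2 hF2].
(* In [hp_dist], the right side is at most [3 * t ^+ 2] and the product of heights at least
   [t ^+ 2 / 4], whence 12. *)
have [r rP] := finite_in_word_ball genS (finite_fro2_le (ler0n R 12)).
exists r => g h a t t0 Xg Yg Xh Yh; apply: rP => /=.
have -> : fro2 (rho (g^-1 * h)%g) = fro2 (invmx (rho g) *m rho h).
  have ug : rho g \in unitmx by rewrite unitmxE det_rho unitr1.
  have := rhoM g (g^-1 * h)%g; rewrite mulgA mulgV mul1g => -[] ->.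
    by rewrite mulKmx.
  by rewrite mulmxN mulKmx// fro2N.
have gh := hp_dist (det_rho g) (det_rho h).
have yg := hp_y_gt0 (det_rho g); have yh := hp_y_gt0 (det_rho h).
rewrite -(ler_pM2r (mulr_gt0 yg yh)) gh.
move: Xg Yg Xh Yh => /andP[X1 X2] /andP[Y1 Y2] /andP[X3 X4] /andP[Y3 Y4].
have xx : (hp_x (rho g) - hp_x (rho h)) ^+ 2 <= t ^+ 2 by nra.
have y1 : hp_y (rho g) ^+ 2 <= t ^+ 2 by nra.
have y2 : hp_y (rho h) ^+ 2 <= t ^+ 2 by nra.
have yy : t / 2 * (t / 2) <= hp_y (rho g) * hp_y (rho h).
  by rewrite ler_pM// ltW// divr_gt0.
lra.
Qed.

End DiscreteGroup.

Section Fuchsian.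
Variable R : realType.

Lemma nbhs_SL2_one (V : set (SL2 R)) : nbhs (1%g : SL2 R) V ->
  exists2 delta : R, 0 < delta &
    forall A : SL2 R, (forall i j, `|(val A - 1%:M) i j| < delta) -> V A.
Proof.
rewrite nbhsE => -[U [[W oW WU] U1] UV].
have : nbhs (1%:M : 'M[R]_2) W.
  by apply: open_nbhs_nbhs; split => //; move: U1; rewrite -WU.
move=> /nbhs_ballP[d d0 dW]; exists d => // A Ad; apply: UV; rewrite -WU /=.
apply: dW; split => // i j; rewrite /ball/= distrC.
by have := Ad i j; rewrite !mxE.
Qed.

(** A neighbourhood isolating the identity separates all pairs [g], [h], by way of [g^-1 * h]. *)
Lemma discrete_group_half_plane (G : groupType) (S : set G) :
  finite_set S -> generates S ->
  (exists i : G -> SL2 R,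
     [/\ {morph i : g h / (g * h)%g}, injective i & discrete_set (range i)]) \/
  (exists i : G -> PSL2 R,
     [/\ {morph i : g h / (g * h)%g}, injective i & discrete_set (range i)]) ->
  exists X Y : G -> R,
  [/\ forall g, 0 < Y g,
      forall r, exists2 K, 1 <= K & forall g h, word_ball S r h ->
        Y (g * h)%g <= K * Y g /\ `|X (g * h)%g - X g| <= K * Y g &
      exists r, forall g h a t, 0 < t ->
        a <= X g <= a + t -> t / 2 <= Y g <= t ->
        a <= X h <= a + t -> t / 2 <= Y h <= t -> word_ball S r (g^-1 * h)%g].
Proof.
move=> finS genS [[i [iM i_inj i_disc]]|[i [iM i_inj i_disc]]].
- have i1 : i 1%g = 1%g.
    by apply: (mulgI (i 1%g)); rewrite -iM !mulg1.
  have iV g : i (g^-1)%g = (i g)^-1%g.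
    by apply: (mulgI (i g)); rewrite -iM !mulgV.
  have [_ [V V1 VE]] := i_disc _ (ex_intro2 _ _ 1%g I i1).
  have [delta d0 dV] := nbhs_SL2_one V1.
  apply: (@half_plane_coordinates _ _ _ (fun g => val (i g)) _ _ delta) => //.
  + by move=> g; apply/eqP/(valP (i g)).
  + by move=> g h; left; rewrite iM.
  + move=> g h gh.
    have : (V `&` range i) ((i g)^-1 * i h)%g.
      by split; [exact: dV|exists (g^-1 * h)%g => //; rewrite iM iV].
    rewrite VE -i1 -iV -iM => /i_inj gh1.
    by rewrite -[h](mulVKg g) gh1 mulg1.
- pose pi : SL2 R -> PSL2 R := \pi_(quotient_group (SL2_center R))%qT.
  have piM A B : pi (A * B)%g = (pi A * pi B)%g by apply/esym/quot_mul_pi.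
  have i1 : i 1%g = 1%g.
    by apply: (mulgI (i 1%g)); rewrite -iM !mulg1.
  have iV g : i (g^-1)%g = (i g)^-1%g.
    by apply: (mulgI (i g)); rewrite -iM !mulgV.
  have [_ [V V1 VE]] := i_disc _ (ex_intro2 _ _ 1%g I i1).
  have V1' : nbhs (1%g : SL2 R) (pi @^-1` V).
    by apply: (@pi_continuous (SL2 R) (quotient_group (SL2_center R))).
  have [delta d0 dV] := nbhs_SL2_one V1'.
  (* Coset representatives multiply only up to sign. *)
  pose lift g : SL2 R := repr (i g : quotient_group (SL2_center R)).
  have liftK g : pi (lift g) = i g by exact: reprK.
  apply: (@half_plane_coordinates _ _ _ (fun g => val (lift g)) _ _ delta) => //.
  + by move=> g; apply/eqP/(valP (lift g)).
  + move=> g h.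
    have : pi (lift g * lift h)%g = pi (lift (g * h)%g).
      by rewrite piM !liftK iM.
    move=> /eqmodP/asboolP /= h1.
    have e : lift (g * h)%g = ((lift g * lift h) * ((lift g * lift h)^-1 * lift (g * h)))%g.
      by rewrite mulVKg.
    case: h1 => /= h1; [left|right]; rewrite e /= h1 ?mulmx1//.
    by rewrite mulmxN mulmx1.
  + move=> g h gh.
    have piV : pi (lift g)^-1%g = (i g)^-1%g.
      apply/esym/mulg1_eq; have := piM (lift g) (lift g)^-1%g.
      by rewrite liftK mulgV => <-.
    have e : pi ((lift g)^-1 * lift h)%g = 1%g.
      suff : (V `&` range i) (pi ((lift g)^-1 * lift h)%g) by move: VE => ->.
      split; first exact: dV.
      by exists (g^-1 * h)%g => //; rewrite piM liftK iM iV piV.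
    rewrite piM liftK piV in e.
    by apply: i_inj; rewrite -[RHS](mulVKg (i g)) e mulg1.
Qed.

End Fuchsian.

(** * Box spaces *)

Section PathMetric.
Variables (R : realType) (X : sgraph).

Lemma path_metric_ge0 (x y : X) : 0 <= path_metric R x y.
Proof.
rewrite /path_metric; set A := [set _ | _ in _].
have [->|A0] := eqVneq A set0; first by rewrite inf0.
by apply: lb_le_inf; [exact/set0P|move=> _ [p _ <-]].
Qed.

Lemma path_metric_le (x : X) p : path (@edge X) x p ->
  path_metric R x (last x p) <= (size p)%:R.
Proof.
move=> xp; apply: ge_inf; last by exists p.
by exists 0 => _ [q _ <-].
Qed.

(** Lengths are integers, so the infimum is attained. Assuming that some path exists excludes the
    value 0 which [inf] takes on the empty set. *)
Lemma path_metric_path (x y : X) (r : R) :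
  (exists p, path (@edge X) x p /\ last x p = y) -> path_metric R x y <= r ->
  exists p, [/\ path (@edge X) x p, last x p = y & (size p)%:R <= r].
Proof.
move=> [p0 p0P] xyr; apply: contrapT => noP.
pose k := (Num.trunc r).+1.
suff : k%:R <= path_metric R x y.
  apply/negP; rewrite -ltNge (le_lt_trans xyr)//.
  have r0 : 0 <= r by apply: le_trans xyr; exact: path_metric_ge0.
  by have /andP[] := truncn_itv r0.
apply: lb_le_inf; first by exists (size p0)%:R, p0.
move=> _ [p [xp py] <-]; rewrite ler_nat /k truncn_lt_nat.
  by rewrite ltNge; apply/negP => pr; apply: noP; exists p.
by apply: le_trans xyr; exact: path_metric_ge0.
Qed.

End PathMetric.

Section BoxSpace.
Variables (R : realType) (G : groupType) (N : normal_subgroup G) (S : set G).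
Variables (X : sgraph) (f : X -> quotient_group N).
Hypothesis f_bij : bijective f.
Hypothesis f_edge : forall x y : X,
  edge x y <-> cayley_edge (quotient_set N S) (f x) (f y).
Local Notation pi := (\pi_(quotient_group N)%qT).

Lemma quot_piM g h : pi (g * h)%g = (pi g * pi h)%g.
Proof. exact/esym/quot_mul_pi. Qed.

Lemma quot_pi1 : pi 1%g = 1%g. Proof. by []. Qed.

Lemma quot_piV g : pi (g^-1)%g = ((pi g)^-1)%g.
Proof. exact/esym/quot_inv_pi. Qed.

Lemma quot_pi_inj g h : pi g = pi h -> nsub N (g^-1 * h)%g.
Proof. by move/eqmodP/asboolP. Qed.

Lemma word_path (x y : X) r g : word_ball S r g -> f y = (f x * pi g)%g ->
  exists p, [/\ path (@edge X) x p, last x p = y & (size p <= r)%N].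
Proof.
have [f' f'K fK] := f_bij.
move=> [w [wr wS ->]] {g}; elim: w r x wr wS => [|s w IH] r x wr wS /=.
  rewrite quot_pi1 mulg1 => /(can_inj f'K) ->.
  by exists [::].
case: r wr => // r wr yE.
pose x' := f' (f x * pi s)%g.
have [p [xp px' pr]] : exists p, [/\ path (@edge X) x' p, last x' p = y & (size p <= r)%N].
  apply: IH => //; first by move=> t tw; apply: wS; rewrite inE tw orbT.
  by rewrite yE quot_piM mulgA fK.
(* A generator that is trivial in the quotient gives no edge; its letter is dropped. *)
have [xx'|xx'] := pselect (x = x').
  by rewrite -xx' in xp px'; exists p; split=> //; rewrite ltnW.
exists (x' :: p); split => //=; rewrite xp andbT.
apply/f_edge; split; first by move=> /(can_inj f'K).
have [Ss|Ss] := wS s (mem_head _ _).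
  exists (pi s); first by exists s.
  by left; rewrite fK.
exists (pi (s^-1)%g); first by exists (s^-1)%g.
by right; rewrite fK quot_piV mulgK.
Qed.

Lemma path_word (x : X) p : path (@edge X) x p ->
  exists2 g, word_ball S (size p) g & f (last x p) = (f x * pi g)%g.
Proof.
elim: p x => [|y p IH] x /=.
  by exists 1%g; [exact: word_ball1|rewrite quot_pi1 mulg1].
move=> /andP[/f_edge[_ [_ [s Ss <-] xy]] /IH[g wg ->]].
have [t [wt ft]] : exists t, word_ball S 1 t /\ f y = (f x * pi t)%g.
  case: xy => xy; first by exists s; split => //; apply: word_ball_gen; left.
  exists (s^-1)%g; split; first by apply: word_ball_gen; right; rewrite invgK.
  by rewrite xy quot_piV mulgK.
exists (t * g)%g; first by rewrite -add1n; exact: word_ballM.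
by rewrite ft quot_piM mulgA.
Qed.

Lemma word_path_metric (x y : X) r g : word_ball S r g -> f y = (f x * pi g)%g ->
  path_metric R x y <= r%:R.
Proof.
move=> wg /(word_path wg)[p [xp <- pr]].
by rewrite (le_trans (path_metric_le R xp))// ler_nat.
Qed.

Lemma path_metric_word (x y : X) r : generates S -> path_metric R x y <= r%:R ->
  exists2 g, word_ball S r g & f y = (f x * pi g)%g.
Proof.
move=> genS xyr.
have [k wk] := genS (repr ((f x)^-1 * f y)%g).
have yE : f y = (f x * pi (repr ((f x)^-1 * f y)%g))%g by rewrite reprK mulVKg.
have [p0 [? ? _]] := word_path wk yE.
have [|p [xp <-]] := path_metric_path _ xyr; first by exists p0.
rewrite ler_nat => pr; have [g gp ->] := path_word xp.
by exists g => //; exact: word_ball_le gp.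
Qed.

(** Walking from the corner lifts each grid point to a word of length at most [2 * (L * D)].
    Neighbouring lifts then differ by a word of length [4 * (L * D)] congruent modulo [N] to one of
    length [D]; the two agree below the injectivity radius. *)
Lemma lift_grid (L D : nat) (c : 'I_L * 'I_L -> X) : generates S ->
  word_ball S (4 * (L * D) + D) `&` nsub N `<=` [set 1%g] ->
  (forall z z', nearby 1 z z' -> path_metric R (c z) (c z') <= D%:R) ->
  exists h : 'I_L * 'I_L -> G,
    (forall z z', nearby 1 z z' -> word_ball S D ((h z)^-1 * h z')%g) /\
    forall z z', f (c z') = (f (c z) * pi ((h z)^-1 * h z'))%g.
Proof.
case: L c => [|L] c genS inj cD.
  by exists (fun=> 1%g); split => -[[]].
have reach m (z : 'I_L.+1 * 'I_L.+1) : (z.1 + z.2 <= m)%N ->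
    exists g, word_ball S (m * D) g /\ f (c z) = (f (c (ord0, ord0)) * pi g)%g.
  elim: m z => [|m IH] [i j]/= ij.
    have -> : i = ord0 by apply: val_inj => /=; lia.
    have -> : j = ord0 by apply: val_inj => /=; lia.
    by exists 1%g; split; [exact: word_ball1|rewrite quot_pi1 mulg1].
  pose z' : 'I_L.+1 * 'I_L.+1 :=
    if (0 < i)%N then (inord i.-1, j) else (i, inord j.-1).
  have iL := ltn_ord i; have jL := ltn_ord j.
  have zz' : nearby 1 z' (i, j).
    by rewrite /nearby /z'; case: ifP => _ /=; rewrite inordK; lia.
  have [|g [wg gE]] := IH z'.
    by rewrite /z'; case: ifP => /=; rewrite inordK; lia.
  have [t wt tE] := path_metric_word genS (cD _ _ zz').
  exists (g * t)%g; split; first by rewrite mulSn addnC; exact: word_ballM.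
  by rewrite tE gE quot_piM mulgA.
have {}reach (z : 'I_L.+1 * 'I_L.+1) :
    exists g, word_ball S (2 * (L.+1 * D)) g /\ f (c z) = (f (c (ord0, ord0)) * pi g)%g.
  have [|g [wg gE]] := reach (2 * L.+1)%N z.
    by have := ltn_ord z.1; have := ltn_ord z.2; lia.
  by exists g; rewrite mulnA.
have [h hP] := choice reach.
have fh z z' : f (c z') = (f (c z) * pi ((h z)^-1 * h z'))%g.
  by rewrite (hP z').2 (hP z).2 -mulgA -quot_piM mulVKg.
exists h; split => // z z' zz'.
have [t wt tE] := path_metric_word genS (cD _ _ zz').
have e : pi t = pi ((h z)^-1 * h z')%g.
  by apply: (mulgI (f (c z))); rewrite -tE -fh.
suff <- : t = ((h z)^-1 * h z')%g by [].
apply/eqP; rewrite -(mulg1_eq (_ : (t^-1 * ((h z)^-1 * h z'))%g = 1%g)) ?invgK//.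
apply: inj; split; last exact: quot_pi_inj.
have -> : (4 * (L.+1 * D) + D = D + (2 * (L.+1 * D) + 2 * (L.+1 * D)))%N by lia.
apply: word_ballM; first exact: word_ballV.
by apply: word_ballM; [apply: word_ballV; exact: (hP z).1|exact: (hP z').1].
Qed.

End BoxSpace.

(** * Warped cones *)

Section WarpedMetric.
Variables (R : realType) (T : metricType R) (G : groupType) (S : set G).
Variables (act : G -> T -> T).
Hypothesis actP : is_action act.
Hypothesis symS : forall s, S s -> S (s^-1)%g.

Section Chains.
Variable t : R.
Hypothesis t0 : 0 < t.

(** Moves within the space at price [t] times the distance, and jumps along generators at price
    1. *)
Inductive chain : R -> T -> T -> Prop :=
| chain_refl y : chain 0 y y
| chain_move c x y z : chain c x y -> chain (c + t * mdist y z) x z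
| chain_jump c x y s : S s -> chain c x y -> chain (c + 1) x (act s y).

Lemma chain_ge0 c y z : chain c y z -> 0 <= c.
Proof.
elim=> // {c y z} [c x y z _ c0|c x y s _ _ c0]; last by rewrite addr_ge0.
by rewrite addr_ge0// mulr_ge0 ?mdist_ge0// ltW.
Qed.

Lemma chain_trans c c' x y z : chain c x y -> chain c' y z -> chain (c + c') x z.
Proof.
move=> xy yz; elim: yz xy => {c' y z} [y|c' y z w _ IH|c' y z s Ss _ IH] xy.
- by rewrite addr0.
- by rewrite addrA; apply: chain_move; exact: IH.
- by rewrite addrA; apply: chain_jump => //; exact: IH.
Qed.

Lemma chain_sym c x y : chain c x y -> chain c y x.
Proof.
elim=> {c x y} [y|c x y z _ IH|c x y s Ss _ IH]; first exact: chain_refl.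
- rewrite addrC; apply: chain_trans IH; rewrite -[X in chain X]add0r metric_sym.
  exact: chain_move (chain_refl _).
- rewrite addrC; apply: chain_trans IH; rewrite -[X in chain X]add0r.
  have {2}-> : y = act (s^-1)%g (act s y) by rewrite -actM// mulVg act1.
  by apply: chain_jump (chain_refl _); exact: symS.
Qed.

(* This is the warped metric; only the bound of the latter from below is needed. *)
Definition chain_metric x y : R := inf [set c | chain c x y].

Lemma chain_metric_le c x y : chain c x y -> chain_metric x y <= c.
Proof. by move=> xy; apply: ge_inf => //; exists 0 => c' /chain_ge0. Qed.

Lemma chain_has_inf x y : has_inf [set c | chain c x y].
Proof.
split; last by exists 0 => c' /chain_ge0.
by exists (0 + t * mdist x y); exact: chain_move (chain_refl _).
Qed.

Lemma chain_metric_lt c x y : chain_metric x y < c -> exists2 c', chain c' x y & c' < c.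
Proof.
rewrite -subr_gt0 => /inf_adherent/(_ (chain_has_inf x y))[c' xy].
by rewrite addrC subrK => c'c; exists c'.
Qed.

Variable lam : R.
Hypothesis lam1 : 1 <= lam.
Hypothesis lip : forall s y z, S s -> mdist (act s y) (act s z) <= lam * mdist y z.

Lemma word_ball_lipschitz k g y z : word_ball S k g ->
  mdist (act g y) (act g z) <= lam ^+ k * mdist y z.
Proof.
have lam0 : 0 <= lam by apply: le_trans lam1.
move=> [w [wk wS ->]]; apply: (@le_trans _ _ (lam ^+ size w * mdist y z)).
  elim: w wS {wk} => [|s w IH] wS /=; first by rewrite !act1// expr0 mul1r.
  have Ss : S s.
    by have [//|/symS] := wS s (mem_head _ _); rewrite invgK.
  rewrite !actM// (le_trans (lip _ _ Ss))// exprS -mulrA ler_wpM2l// IH// => u uw.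
  by apply: wS; rewrite inE uw orbT.
by rewrite ler_wpM2r ?mdist_ge0// ler_weXn2l.
Qed.

(** All jumps can be made first: each costs 1, so [k] is at most the cost, and pushing a move
    through a jump stretches it by at most [lam]. *)
Lemma chain_word c y z : chain c y z -> exists k g,
  [/\ word_ball S k g, k%:R <= c & t * mdist (act g y) z <= lam ^+ k * c].
Proof.
have lam0 : 0 <= lam by apply: le_trans lam1.
elim=> {c y z} [y|c x y z _ [k [g [gk kc gy]]]|c x y s Ss xy [k [g [gk kc gy]]]].
- exists 0%N, 1%g; split => //; first exact: word_ball1.
  by rewrite act1// mdistxx !mulr0.
- have tm : 0 <= t * mdist y z by rewrite mulr_ge0 ?mdist_ge0// ltW.
  exists k, g; split => //; first by rewrite (le_trans kc)// lerDl.
  apply: (@le_trans _ _ (t * (mdist (act g x) y + mdist y z))).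
    by rewrite ler_pM2l// metric_triangle.
  by rewrite !mulrDr lerD// ler_peMl// exprn_ege1.
- exists k.+1, (s * g)%g; split.
  + by rewrite -add1n; apply: word_ballM => //; apply: word_ball_gen; left.
  + by rewrite -natr1 lerD2r.
  + rewrite actM// exprS -mulrA.
    apply: (@le_trans _ _ (lam * (t * mdist (act g x) y))).
      by rewrite mulrCA ler_pM2l// lip.
    rewrite ler_wpM2l// (le_trans gy)// ler_wpM2l ?exprn_ge0// lerDl//.
Qed.

Lemma chain_metric_admissible : warped_admissible S act t chain_metric.
Proof.
split.
- split=> [y z|y z|x y z].
  + split => [yz|->]; last first.
      apply/eqP; rewrite eq_le chain_metric_le/=; last exact: chain_refl.
      by apply: lb_le_inf; [case: (chain_has_inf z z)|move=> c /chain_ge0].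
    apply: mdist_positivity; apply/eqP; rewrite eq_le mdist_ge0 andbT leNgt.
    apply/negP => yz0.
    (* A chain of cost below 1 has no jump, so its cost is at least [t * mdist y z]. *)
    have e0 : 0 < Num.min 1 (t * mdist y z) by rewrite lt_min ltr01 mulr_gt0.
    rewrite -yz in e0; have [c cyz] := chain_metric_lt e0.
    rewrite lt_min => /andP[c1 ct].
    have [k [g [gk kc]]] := chain_word cyz.
    have k0 : k = 0%N.
      by apply/eqP; rewrite -leqn0 -ltnS -(ltr_nat R) (le_lt_trans kc).
    move: gk; rewrite k0 => -[w [+ _ ->]]; rewrite leqn0 => /nilP -> /=.
    by rewrite act1// expr0 mul1r leNgt ct.
  + by congr inf; apply/seteqP; split => c; exact: chain_sym.
  + apply/ler_addgt0Pr => e e0; have e2 : 0 < e / 2 by rewrite divr_gt0.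
    have lt_add u v : chain_metric u v < chain_metric u v + e / 2 by rewrite ltrDl.
    have [c cxy c1] := chain_metric_lt (lt_add x y).
    have [c' cyz c'1] := chain_metric_lt (lt_add y z).
    by rewrite (le_trans (chain_metric_le (chain_trans cxy cyz)))//; lra.
- move=> y z; rewrite -[leRHS]add0r; apply: chain_metric_le.
  exact: chain_move (chain_refl _).
- move=> s y Ss; rewrite -[leRHS]add0r; apply: chain_metric_le.
  exact: chain_jump (chain_refl _).
Qed.

Lemma warped_metric_word d (c : R) y z : is_warped_metric S act t d -> d y z < c ->
  exists k g, [/\ word_ball S k g, k%:R <= c & t * mdist (act g y) z <= lam ^+ k * c].
Proof.
move=> [_ /(_ _ chain_metric_admissible y z) h] dc.
have [c' /chain_word[k [g [gk kc gy]]] c'c] := chain_metric_lt (le_lt_trans h dc).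
exists k, g; split => //; first exact: le_trans kc (ltW c'c).
apply: (le_trans gy); apply: ler_wpM2l (ltW c'c).
by rewrite exprn_ge0// (le_trans _ lam1).
Qed.

End Chains.
End WarpedMetric.

Lemma nat_distP (R : realType) (i j k : nat) :
  (`|i%:R - j%:R| <= k%:R :> R) = (i <= j + k)%N && (j <= i + k)%N.
Proof.
rewrite ler_norml lerBlDr lerBrDl -!natrD ler_nat [(k + j)%N]addnC andbC; congr andb.
by rewrite lerBlDr -natrD ler_nat.
Qed.

(** The grid has mesh [1 / t] in the chart about [phi y0]. A short nontrivial word moves [y0], hence
    the whole tiny grid, too far at high levels, so only moves inside the chart remain. [rho] is
    found before [L]; only the level depends on [L]. *)
Lemma bilipschitz_free_orbit_grid (R : realType) (T : pmetricType R)
    (G : groupType) (S : set G) (act : G -> T -> T)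
    (y0 : T) (U : set T) (phi : T -> R * R) (K : R) :
  finite_set S -> (forall s, S s -> S (s^-1)%g) -> is_action act ->
  (forall h, exists k : R, forall y y', mdist (act h y) (act h y') <= k * mdist y y') ->
  (forall h, act h y0 = y0 -> h = 1%g) ->
  U y0 -> open (phi @` U) -> 1 <= K ->
  (forall x y, U x -> U y ->
     K^-1 * mdist x y <= `|phi x - phi y| <= K * mdist x y) ->
  forall r : R, exists rho : nat, forall L : nat, exists n0 : nat,
    forall (n : nat) (d : T -> T -> R), (n0 <= n)%N ->
    is_warped_metric S act n.+1%:R d ->
    exists c : 'I_L * 'I_L -> T,
      (forall z z', nearby 1 z z' -> d (c z) (c z') <= K) /\
      (forall z z', d (c z) (c z') <= r -> nearby rho z z').
Proof.
move=> finS symS actP lip free Uy0 oU K1 Kphi r.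
have K0 : 0 < K by apply: lt_le_trans K1.
have [lam lam1 lamP] : exists2 lam : R, 1 <= lam &
    forall s y z, S s -> mdist (act s y) (act s z) <= lam * mdist y z.
  have [k kP] := choice lip.
  have [F FP] := finite_set_ubound k finS.
  exists (Num.max 1 F) => [|s y z Ss]; first by rewrite le_max lexx.
  rewrite (le_trans (kP _ _ _))// ler_wpM2r ?mdist_ge0//.
  by rewrite le_max FP ?orbT.
have lam0 : 0 <= lam by apply: le_trans lam1.
pose r1 := `|r| + 1.
pose m := Num.trunc r1.
pose C := lam ^+ m * r1.
have r10 : 0 <= r1 by rewrite addr_ge0.
have C0 : 0 <= C by rewrite mulr_ge0// exprn_ge0.
exists (Num.trunc (K * C)).+1 => L.
have [e e0 eP] : exists2 e : R, 0 < e &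
    forall g, word_ball S m g -> g <> 1%g -> e <= mdist (act g y0) y0.
  have [F FP] := finite_set_ubound (fun g => (mdist (act g y0) y0)^-1)
                                   (finite_word_ball m finS).
  exists (`|F| + 1)^-1 => [|g gm g1]; first by rewrite invr_gt0 ltr_wpDl.
  have dg : 0 < mdist (act g y0) y0.
    by rewrite mdist_gt0; apply/eqP => /free.
  rewrite -[leRHS]invrK lef_pV2 ?posrE ?invr_gt0 ?ltr_wpDl//.
  by rewrite (le_trans (FP _ gm))// (le_trans (ler_norm F))// lerDl.
have [delta delta0 deltaP] : exists2 delta : R, 0 < delta &
    forall p, `|p - phi y0| < delta -> exists2 y, U y & phi y = p.
  have : nbhs (phi y0) (phi @` U) by apply: open_nbhs_nbhs; split=> //; exists y0.
  move=> /nbhs_ballP[delta delta0 h]; exists delta => // p pd.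
  have [|y Uy <-] := h p; last by exists y.
  by rewrite -ball_normE /ball_/= distrC.
(* Beyond [B1] the grid fits into the image of the chart; beyond [B2] it is too small for a
   nontrivial word of length at most [m]. *)
pose B1 := L%:R / delta; pose B2 := ((lam ^+ m + 1) * (K * L%:R) + C) / e.
have B1_ge0 : 0 <= B1 by rewrite divr_ge0// ltW.
have B2_ge0 : 0 <= B2.
  apply: divr_ge0; last exact: ltW.
  by rewrite addr_ge0// mulr_ge0 ?addr_ge0 ?exprn_ge0// mulr_ge0// ltW.
have B0 : 0 <= B1 + B2 by rewrite addr_ge0.
exists (Num.bound (B1 + B2)) => n d n0n dP.
set t : R := n.+1%:R; have t0 : 0 < t by rewrite ltr0n.
have [tB1 tB2] : B1 < t /\ B2 < t.
  suff : B1 + B2 < t by split; lra.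
  by rewrite (lt_le_trans (archi_boundP B0))// ler_nat ltnW.
pose p (z : 'I_L * 'I_L) : R * R := ((z.1 : nat)%:R / t, (z.2 : nat)%:R / t).
have pdist z z' : `|p z - p z'| = Num.max `|(z.1 : nat)%:R - (z'.1 : nat)%:R|
                    `|(z.2 : nat)%:R - (z'.2 : nat)%:R| / t.
  have tV0 : 0 <= t^-1 by rewrite invr_ge0 ltW.
  rewrite prod_normE /= -!mulrBl !normrM (ger0_norm tV0).
  by rewrite maxr_pMl.
have p_le z : `|p z| <= L%:R / t.
  rewrite prod_normE ge_max /= !ger0_norm ?divr_ge0 ?(ltW t0)//.
  by rewrite !ler_pdivrMr// !divfK ?gt_eqF// !ler_nat !(ltnW (ltn_ord _)).
have lift z : exists y, U y /\ phi y = phi y0 + p z.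
  have [|y Uy yE] := deltaP (phi y0 + p z); last by exists y.
  rewrite addrAC subrr add0r (le_lt_trans (p_le z))//.
  by rewrite ltr_pdivrMr// [delta * t]mulrC -ltr_pdivrMr.
have [c cP] := choice lift.
have cdist z z' : K^-1 * mdist (c z) (c z') <= `|p z - p z'| <= K * mdist (c z) (c z').
  have [Uz Ez] := cP z; have [Uz' Ez'] := cP z'.
  by have := Kphi _ _ Uz Uz'; rewrite Ez Ez' opprD addrACA subrr add0r.
have c_y0 z : mdist (c z) y0 <= K * L%:R / t.
  have [Uz Ez] := cP z; have /andP[+ _] := Kphi _ _ Uz Uy0.
  rewrite Ez addrAC subrr add0r ler_pdivrMl// => h.
  by rewrite (le_trans h)// -mulrA ler_pM2l.
exists c; split => z z' zz'.
- have [[_ d_le _] _] := dP; rewrite (le_trans (d_le _ _))//.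
  have /andP[+ _] := cdist z z'; rewrite ler_pdivrMl// => h.
  rewrite -/t; apply: (@le_trans _ _ (t * (K * `|p z - p z'|))); first by rewrite ler_pM2l.
  have -> : t * (K * `|p z - p z'|) = K * (`|p z - p z'| * t) by ring.
  rewrite -[leRHS]mulr1 ler_pM2l// pdist divfK ?gt_eqF// ge_max.
  by have /and4P[h1 h2 h3 h4] := zz'; rewrite !(nat_distP R _ _ 1) h1 h2 h3 h4.
- have dlt : d (c z) (c z') < r1.
    by rewrite (le_lt_trans zz')// (le_lt_trans (ler_norm _))// ltrDl.
  have [k [g [gk kr gz]]] := warped_metric_word actP symS t0 lam1 lamP dP dlt.
  have km : (k <= m)%N.
    rewrite -ltnS -(ltr_nat R) (le_lt_trans kr)//.
    by have /andP[] := truncn_itv r10.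
  have gC : t * mdist (act g (c z)) (c z') <= C.
    by rewrite (le_trans gz)// ler_wpM2r// ler_weXn2l.
  have g1 : g = 1%g.
    apply: contrapT => g1; have := eP g (word_ball_le km gk) g1.
    apply/negP; rewrite -ltNge -(ltr_pM2l t0).
    have tri : mdist (act g y0) y0 <= lam ^+ m * (K * L%:R / t) +
        mdist (act g (c z)) (c z') + K * L%:R / t.
      apply: (le_trans (metric_triangle _ (act g (c z)) _)).
      rewrite -addrA lerD//.
        rewrite (le_trans (word_ball_lipschitz actP symS lam1 lamP _ _ gk))//.
        by rewrite ler_pM ?mdist_ge0 ?exprn_ge0 ?ler_weXn2l// metric_sym c_y0.
      by rewrite (le_trans (metric_triangle _ (c z') _))// lerD.
    have tKL : t * (K * L%:R / t) = K * L%:R by field; rewrite gt_eqF.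
    have {}tri := ler_wpM2l (ltW t0) tri.
    rewrite !mulrDr [t * (lam ^+ m * _)]mulrCA tKL in tri.
    rewrite ltr_pdivrMr// in tB2.
    by rewrite (le_lt_trans tri)// (le_lt_trans _ tB2)//; lra.
  rewrite g1 act1// in gC.
  have pC : t * `|p z - p z'| <= K * C.
    have /andP[_ h] := cdist z z'.
    apply: (@le_trans _ _ (t * (K * mdist (c z) (c z')))); first by rewrite ler_pM2l.
    by rewrite mulrCA ler_pM2l.
  have : Num.max `|(z.1 : nat)%:R - (z'.1 : nat)%:R| `|(z.2 : nat)%:R - (z'.2 : nat)%:R|
      <= (Num.trunc (K * C)).+1%:R :> R.
    rewrite pdist mulrC divfK ?gt_eqF// in pC; rewrite (le_trans pC)// ltW//.
    by have /andP[] := truncn_itv (mulr_ge0 (ltW K0) C0).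
  by rewrite ge_max !nat_distP => /andP[/andP[h1 h2] /andP[h3 h4]]; apply/and4P.
Qed.

(** * Coarse embeddings *)

Theorem theorem7p1 (R : realType) (X Y : nat -> sgraph) :
  margulis_type_expander R X -> selberg_type_expander R Y ->
  ~ coarsely_embeds (fun n => @path_metric R (X n))
                    (fun n => @path_metric R (Y n)).
Proof.
move=> [_ [g [T [mu [G [S [act [dcone]]]]]]]].
move=> [[_ _ charts] [finS symS genS] [actP lip _ [y0 free]] warped].
move=> [f [Lq [A [Lq1 A0 fq fA]]]].
move=> [_ [H [SH [finSH genSH Hdisc [N [_ inj isom]]]]]].
move=> [F [eta [zeta [pos mono eta_oo Fq]]]].
have [px [py [py0 hp_lip [r0 hp_tile]]]] := discrete_group_half_plane finSH genSH Hdisc.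
have Lq0 : 0 < Lq by apply: lt_le_trans Lq1.
have [U [phi [Uy0 [_ oU [Kc Kc1 [Kphi _]]]]]] := charts y0.
have free' h : act h y0 = y0 -> h = 1%g by exact: free.
have cone := bilipschitz_free_orbit_grid finS symS actP lip free' Uy0 oU Kc1 Kphi.
(* Neighbours are at distance at most [Kc] in the cone; replacing both by points within [A + 1] adds
   [2 * A + 2], and the quasi-isometry adds another [A]. *)
pose DX := Lq * (Kc + 3 * A + 2).
have DX0 : 0 <= DX by rewrite mulr_ge0//; lra.
pose D := (Num.trunc (zeta DX)).+1.
have [K K1 KP] := hp_lip D.
have [r1 r1P] : exists r1, forall s, r1 < s -> r0%:R < eta s.
  have /cvgryPgt/(_ r0%:R) [r1 [_ h]] := eta_oo.
  by exists r1.
have r1P' s : eta s <= r0%:R -> s <= r1.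
  by rewrite leNgt => h; rewrite leNgt; apply: contra h; exact: r1P.
(* The same error terms in the other direction. This [rho] fixes the multiplicity, which fixes the
   grid size [L], and only then is [n] taken large. *)
have [rho rhoP] := cone (Lq * r1 + 3 * A + 2).
have [L noL] := no_coarse_grid (rho.+1 * rho.+1) K1.
have [n0 n0P] := rhoP L.
have [n1 n1P] := inj (4 * (L * D) + D)%N.
pose n := maxn n0 n1.
have [c [c1 c2]] := n0P n (dcone n) (leq_maxl _ _) (warped n).
have [fY fY_bij fY_edge] := isom n.
have dXge0 := @path_metric_ge0 R (X n).
have [[d_met _ _] _] := warped n; have [_ d_sym d_tri] := d_met.
have near z : exists x, dcone n (c z) (f n x) < A + 1 by exact: fA.
have [x xP] := choice near.
have dX_cone z z' : dcone n (f n (x z)) (f n (x z')) <= dcone n (c z) (c z') + 2 * A + 2.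
  have := d_tri (f n (x z)) (c z) (f n (x z')).
  have := d_tri (c z) (c z') (f n (x z')).
  rewrite (d_sym (f n (x z)) (c z)); have := xP z; have := xP z'; lra.
have cone_dX z z' : dcone n (c z) (c z') <= dcone n (f n (x z)) (f n (x z')) + 2 * A + 2.
  have := d_tri (c z) (f n (x z)) (c z').
  have := d_tri (f n (x z)) (f n (x z')) (c z').
  rewrite (d_sym (f n (x z')) (c z')); have := xP z; have := xP z'; lra.
have FD z z' : nearby 1 z z' -> path_metric R (F n (x z)) (F n (x z')) <= D%:R.
  move=> zz'; have /andP[_ h] := Fq n (x z) (x z'); apply: (le_trans h).
  have dX_DX : path_metric R (x z) (x z') <= DX.
    have /andP[+ _] := fq n (x z) (x z').
    have := dX_cone z z'; have := c1 _ _ zz' => h1 h2 h3.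
    rewrite /DX -ler_pdivrMl//; lra.
  have : zeta (path_metric R (x z) (x z')) <= zeta DX.
    by apply: (mono _ _ _).2; rewrite dXge0.
  move=> h1; apply: (le_trans h1); apply: ltW; have [_ z0] := pos _ DX0.
  by have /andP[] := truncn_itv z0.
have n_inj : word_ball SH (4 * (L * D) + D) `&` nsub (N n) `<=` [set 1%g].
  rewrite -n1P => u [u1 u2]; split => //; exists n => //=; exact: leq_maxr.
have [h [h1 h2]] := lift_grid fY_bij fY_edge genSH n_inj FD.
apply: (noL (fun z => px (h z)) (fun z => py (h z))) => [z|z z' zz'|a t t0].
- exact: py0.
- by have := KP (h z) _ (h1 _ _ zz'); rewrite mulVKg.
(* Points in one box differ by a word of length at most [r0], so they are within [r0] in [Y], then
   within [r1] in [X], and finally [nearby rho] in the grid. *)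
- apply: nearby_card => z z'; rewrite !inE => /andP[Xz Yz] /andP[Xz' Yz'].
  have w := hp_tile _ _ _ _ t0 Xz Yz Xz' Yz'.
  have Fr := word_path_metric R fY_bij fY_edge w (h2 z z').
  apply: c2; apply: (le_trans (cone_dX z z')).
  have /andP[eF _] := Fq n (x z) (x z').
  have xr1 := r1P' _ (le_trans eF Fr).
  have /andP[_ fxr] := fq n (x z) (x z').
  have := ler_wpM2l (ltW Lq0) xr1; lra.
Qed.
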